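(* Let $\alpha>0$, $\beta\geq0$, and let $g\in H(\mathbb D)$ be such that $g$ has no zeros in $\mathbb D$ and an analytic branch of $\log(g)$ belongs to $\mathcal B$. Then $S_g: H^{\infty}_\alpha\rightarrow H^{\infty}_\beta$ is bounded if and only if $$\limsup_{t\rightarrow1^-}\sup_{0\leq\theta<2\pi}(1-t^2)^\beta\int_0^t\frac{|g(re^{i\theta})|}{(1-r^2)^{\alpha+1}}\,dr<+\infty\,.$$
   Context: $\mathbb D$ is the open unit disk and $H(\mathbb D)$ the space of analytic functions on $\mathbb D$. For $\alpha\geq0$, $H^{\infty}_\alpha=\{f\in H(\mathbb D): \|f\|_{H^\infty_\alpha}:=\sup_{z\in\mathbb D}(1-|z|^2)^\alpha|f(z)|<\infty\}$. The Bloch space is $\mathcal B=\{f\in H(\mathbb D): |f(0)|+\sup_{z\in\mathbb D}(1-|z|^2)|f'(z)|<\infty\}$. For $g\in H(\mathbb D)$, $(S_gf)(z)=\int_0^z f'(\omega)g(\omega)\,d\omega$. *)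

(* Defs.v *)
From Stdlib Require Import Reals Lra ClassicalEpsilon.
Open Scope R_scope.

Definition Cplx := (R * R)%type.
Definition Cadd (z w : Cplx) : Cplx := (fst z + fst w, snd z + snd w).
Definition Csub (z w : Cplx) : Cplx := (fst z - fst w, snd z - snd w).
Definition Cmul (z w : Cplx) : Cplx :=
  (fst z * fst w - snd z * snd w, fst z * snd w + snd z * fst w).
Definition Cscale (t : R) (z : Cplx) : Cplx := (t * fst z, t * snd z).
Definition Cnorm (z : Cplx) : R := sqrt (fst z ^ 2 + snd z ^ 2).
Definition C0 : Cplx := (0, 0).
Definition Cexp (z : Cplx) : Cplx := (exp (fst z) * cos (snd z), exp (fst z) * sin (snd z)).
Definition polar (r theta : R) : Cplx := (r * cos theta, r * sin theta).

Definition in_D (z : Cplx) : Prop := Cnorm z < 1.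

Definition is_cderiv_at (f : Cplx -> Cplx) (z l : Cplx) : Prop :=
  forall eps, 0 < eps -> exists del, 0 < del /\
    forall h, Cnorm h < del ->
      Cnorm (Csub (Csub (f (Cadd z h)) (f z)) (Cmul l h)) <= eps * Cnorm h.

Definition holo_D (f : Cplx -> Cplx) : Prop :=
  forall z, in_D z -> exists l, is_cderiv_at f z l.

Definition deriv_D (f f' : Cplx -> Cplx) : Prop :=
  forall z, in_D z -> is_cderiv_at f z (f' z).

(* Riemann integral of f over [a,b] (value when f is Riemann integrable;
   all integrands used below are continuous on the relevant interval) *)
Definition RInt (f : R -> R) (a b : R) : R :=
  epsilon (inhabits 0)
    (fun I => exists pr : Riemann_integrable f a b, RiemannInt pr = I).

(* (S_g f)(z) = int_0^z f'(w) g(w) dw, along the segment w = t z, t in [0,1]: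
   = int_0^1 f'(t z) g(t z) z dt *)
Definition Sg (g f' : Cplx -> Cplx) (z : Cplx) : Cplx :=
  let F := fun t => Cmul (Cmul (f' (Cscale t z)) (g (Cscale t z))) z in
  (RInt (fun t => fst (F t)) 0 1, RInt (fun t => snd (F t)) 0 1).

Definition in_Bloch (h h' : Cplx -> Cplx) : Prop :=
  deriv_D h h' /\
  exists M, forall z, in_D z -> (1 - Cnorm z ^ 2) * Cnorm (h' z) <= M.

Definition Sg_bounded (alpha beta : R) (g : Cplx -> Cplx) : Prop :=
  exists K, forall f f' : Cplx -> Cplx, deriv_D f f' ->
    forall M, (forall z, in_D z -> Rpower (1 - Cnorm z ^ 2) alpha * Cnorm (f z) <= M) ->
    forall z, in_D z -> Rpower (1 - Cnorm z ^ 2) beta * Cnorm (Sg g f' z) <= K * M.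

Definition Phi (alpha beta : R) (g : Cplx -> Cplx) (t theta : R) : R :=
  Rpower (1 - t ^ 2) beta *
  RInt (fun r => Cnorm (g (polar r theta)) / Rpower (1 - r ^ 2) (alpha + 1)) 0 t.

Definition limsup_finite (alpha beta : R) (g : Cplx -> Cplx) : Prop :=
  exists M t0, 0 <= t0 < 1 /\
    forall t, t0 < t < 1 -> forall theta, 0 <= theta < 2 * PI ->
      Phi alpha beta g t theta <= M.

(* Main.v *)
(* Boundedness implies the integral condition: write [g = exp h].  In the hyperbolic
   parameter [s] along a radius, [U = Im h] is Lipschitz because [h] is a Bloch function.
   A sum of kernels [exp (- i U(s_n)) B_n^p (1 - z)^j / (1 - a_n z)^m] over equally spaced
   nodes [s_n] is then a derivative [f'] with [f] in [H^infty_alpha], uniformly, and for [j]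
   large every kernel is concentrated near its node at the scale where [U] is almost
   constant.  Hence [Re (f' exp (i U)) >= c (1 - r^2)^(- alpha - 1)] along the radius, and
   [Re (S_g f)] dominates the integral of the theorem.

   Conversely, use Cauchy's estimate [|f'(z)| <= C (1 - |z|^2)^(- alpha - 1)], integrated along
   the radius.  As only complex differentiability is assumed, Cauchy's estimate and the
   continuity of [f'] come from Goursat's theorem for rectangles: the function
   [(f(w) - f(z) - f'(z) (w - z)) / (w - z)^2] has the same integral over all squares
   centred at [z], and that integral tends to [0] with the square. *)
Require Import Defs.
From Stdlib Require Import Reals Lra Lia Psatz ClassicalEpsilon Classical.
From Coquelicot Require Import Coquelicot.
Open Scope R_scope.

(** * Complex differentiation *)

(** A higher power of [1 - a_n z] alone would not concentrate a kernel. With [B = 1 - a_n^2],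
    [X = 1 - r^2], [D = 1 - a_n r], the quantity [B^p X^(alpha + 1) / D^(p + alpha + 1)] decays from
    the node towards the boundary only like [rho^(alpha + 1)], where [rho = B X / D^2], because
    [B / D] stays of order one there. The zero of [(1 - z)^j] raises this exponent by [j], and
    [|1 - z| <= 2 |1 - a_n z|] keeps all bounds uniform in [a_n] off the radius. Constants are fixed
    in the order: Lipschitz constant, node spacing, [j]. The spacing makes the phase error at nearby
    nodes at most 1; then [j] makes the far nodes negligible against the nearest one, as both
    contributions carry a [j]-th power, with different bases. Only the number of nodes depends on
    how far along the radius the estimate is wanted. Continuity of [f'] matters because [Sg]
    integrates [f'] itself, and its integral has a meaning only for Riemann integrable functions. *)

Lemma cderiv_def (f : C -> C) (z l : C) :
  is_cderiv_at f z l <->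
  (forall eps, 0 < eps -> exists del, 0 < del /\ forall w : C, Cmod (w - z) < del ->
     Cmod (f w - f z - l * (w - z)) <= eps * Cmod (w - z)).
Proof.
  split; intros H eps Heps; destruct (H eps Heps) as [d [Hd Hw]];
    exists d; (split; [exact Hd|]).
  - intros w Hwz. specialize (Hw (w - z)%C Hwz).
    change (Cmod (f (z + (w - z)) - f z - l * (w - z))%C <= eps * Cmod (w - z)) in Hw.
    replace (z + (w - z))%C with w in Hw by ring. exact Hw.
  - change (forall h : C, Cmod h < d -> Cmod (f (z + h) - f z - l * h)%C <= eps * Cmod h).
    intros h Hh. specialize (Hw (z + h)%C).
    replace (z + h - z)%C with h in Hw by ring. exact (Hw Hh).
Qed.

Lemma cderiv_ext (f g : C -> C) (z l : C) : (forall w, f w = g w) ->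
  is_cderiv_at f z l -> is_cderiv_at g z l.
Proof.
  intros E. rewrite !cderiv_def. intros H eps Heps.
  destruct (H eps Heps) as [d [Hd Hw]]. exists d; split; [exact Hd|].
  intros w Hwz. rewrite <- !E. exact (Hw w Hwz).
Qed.

Lemma cderiv_lip (f : C -> C) (z l : C) : is_cderiv_at f z l ->
  exists del, 0 < del /\ forall w : C, Cmod (w - z) < del ->
    Cmod (f w - f z) <= (Cmod l + 1) * Cmod (w - z).
Proof.
  intros H. destruct (proj1 (cderiv_def f z l) H 1 Rlt_0_1) as [d [Hd Hw]].
  exists d; split; [exact Hd|]. intros w Hwz. specialize (Hw w Hwz).
  replace (f w - f z)%C with (l * (w - z) + (f w - f z - l * (w - z)))%C by ring.
  eapply Rle_trans; [apply Cmod_triangle|]. rewrite Cmod_mult. lra.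
Qed.

Lemma cderiv_const (c z : C) : is_cderiv_at (fun _ => c) z (RtoC 0).
Proof.
  apply cderiv_def. intros eps Heps. exists 1; split; [lra|]. intros w _.
  replace (c - c - 0 * (w - z))%C with (RtoC 0) by ring. rewrite Cmod_0.
  generalize (Cmod_ge_0 (w - z)). nra.
Qed.

Lemma cderiv_id (z : C) : is_cderiv_at (fun w => w) z (RtoC 1).
Proof.
  apply cderiv_def. intros eps Heps. exists 1; split; [lra|]. intros w _.
  replace (w - z - 1 * (w - z))%C with (RtoC 0) by ring. rewrite Cmod_0.
  generalize (Cmod_ge_0 (w - z)). nra.
Qed.

Lemma cderiv_plus (f g : C -> C) (z l m : C) : is_cderiv_at f z l -> is_cderiv_at g z m ->
  is_cderiv_at (fun w => f w + g w)%C z (l + m)%C.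
Proof.
  rewrite !cderiv_def. intros Hf Hg eps Heps.
  destruct (Hf (eps / 2)) as [d1 [H1 F]]; [lra|].
  destruct (Hg (eps / 2)) as [d2 [H2 G]]; [lra|].
  exists (Rmin d1 d2); split; [apply Rmin_pos; lra|]. intros w Hw.
  specialize (F w (Rlt_le_trans _ _ _ Hw (Rmin_l _ _))).
  specialize (G w (Rlt_le_trans _ _ _ Hw (Rmin_r _ _))).
  replace (f w + g w - (f z + g z) - (l + m) * (w - z))%C with
    ((f w - f z - l * (w - z)) + (g w - g z - m * (w - z)))%C by ring.
  eapply Rle_trans; [apply Cmod_triangle|]. lra.
Qed.

Lemma cderiv_mult (f g : C -> C) (z l m : C) : is_cderiv_at f z l -> is_cderiv_at g z m ->
  is_cderiv_at (fun w => f w * g w)%C z (l * g z + f z * m)%C.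
Proof.
  intros Hf Hg.
  destruct (cderiv_lip _ _ _ Hf) as [d3 [H3 F']]. destruct (cderiv_lip _ _ _ Hg) as [d4 [H4 G']].
  rewrite cderiv_def in Hf, Hg. apply cderiv_def. intros eps Heps.
  set (A := Cmod (f z)). set (B := Cmod (g z)). set (L := Cmod l + 1). set (M := Cmod m + 1).
  assert (HA : 0 <= A) by apply Cmod_ge_0. assert (HB : 0 <= B) by apply Cmod_ge_0.
  assert (HL : 1 <= L) by (generalize (Cmod_ge_0 l); unfold L; lra).
  assert (HM : 1 <= M) by (generalize (Cmod_ge_0 m); unfold M; lra).
  (* [e] controls the two terms linear in the remainders of [f] and [g]; [d5] below controls the
     product of the two increments, quadratic in [Cmod (w - z)]. *)
  set (e := eps / (3 * (A + B + 1))).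
  assert (He : 0 < e) by (apply Rdiv_lt_0_compat; lra).
  assert (Hee : e * (A + B + 1) = eps / 3) by (unfold e; field; lra).
  destruct (Hf e He) as [d1 [H1 F]]. destruct (Hg e He) as [d2 [H2 G]].
  set (d5 := eps / (3 * (L * M))).
  assert (H5 : 0 < d5) by (apply Rdiv_lt_0_compat; nra).
  assert (H5' : d5 * (L * M) = eps / 3) by (unfold d5; field; nra).
  exists (Rmin (Rmin d1 d2) (Rmin (Rmin d3 d4) d5)). split.
  { repeat apply Rmin_pos; lra. }
  intros w Hw.
  assert (Hw' : Cmod (w - z) < d1 /\ Cmod (w - z) < d2 /\ Cmod (w - z) < d3 /\
    Cmod (w - z) < d4 /\ Cmod (w - z) < d5).
  { generalize (Rmin_l (Rmin d1 d2) (Rmin (Rmin d3 d4) d5))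
      (Rmin_r (Rmin d1 d2) (Rmin (Rmin d3 d4) d5)) (Rmin_l d1 d2) (Rmin_r d1 d2)
      (Rmin_l (Rmin d3 d4) d5) (Rmin_r (Rmin d3 d4) d5) (Rmin_l d3 d4) (Rmin_r d3 d4). lra. }
  destruct Hw' as (W1 & W2 & W3 & W4 & W5).
  specialize (F w W1). specialize (G w W2). specialize (F' w W3). specialize (G' w W4).
  replace (f w * g w - f z * g z - (l * g z + f z * m) * (w - z))%C with
    ((f w - f z - l * (w - z)) * g z + f z * (g w - g z - m * (w - z))
     + (f w - f z) * (g w - g z))%C by ring.
  eapply Rle_trans; [apply Cmod_triangle|].
  eapply Rle_trans; [apply Rplus_le_compat_r, Cmod_triangle|].
  rewrite !Cmod_mult. fold A B. fold L in F'. fold M in G'.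
  set (t := Cmod (w - z)) in *. assert (Ht : 0 <= t) by apply Cmod_ge_0.
  assert (T1 : Cmod (f w - f z - l * (w - z)) * B <= e * t * B) by (apply Rmult_le_compat_r; lra).
  assert (T2 : A * Cmod (g w - g z - m * (w - z)) <= A * (e * t)) by (apply Rmult_le_compat_l; lra).
  assert (T3 : Cmod (f w - f z) * Cmod (g w - g z) <= (L * t) * (M * t)).
  { apply Rmult_le_compat; try apply Cmod_ge_0; lra. }
  assert (T4 : (L * t) * (M * t) <= eps / 3 * t).
  { replace ((L * t) * (M * t)) with ((t * (L * M)) * t) by ring.
    apply Rmult_le_compat_r; [lra|]. rewrite <- H5'. apply Rmult_le_compat_r; nra. }
  assert (T5 : e * t * B + A * (e * t) <= eps / 3 * t).
  { rewrite <- Hee. nra. }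
  apply Rle_trans with (e * t * B + A * (e * t) + L * t * (M * t)).
  { repeat apply Rplus_le_compat; assumption. }
  assert (0 <= eps * t) by (apply Rmult_le_pos; lra). lra.
Qed.

Lemma cderiv_affine (f : C -> C) (a b z l : C) : is_cderiv_at f (a * z + b)%C l ->
  is_cderiv_at (fun w => f (a * w + b))%C z (l * a)%C.
Proof.
  rewrite !cderiv_def. intros Hf eps Heps.
  set (A := Cmod a + 1). assert (HA : 1 <= A) by (generalize (Cmod_ge_0 a); unfold A; lra).
  destruct (Hf (eps / A)) as [d [Hd F]]; [apply Rdiv_lt_0_compat; lra|].
  exists (d / A); split; [apply Rdiv_lt_0_compat; lra|]. intros w Hw.
  assert (Hm : Cmod (a * w + b - (a * z + b)) <= A * Cmod (w - z)).
  { replace (a * w + b - (a * z + b))%C with (a * (w - z))%C by ring. rewrite Cmod_mult.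
    apply Rmult_le_compat_r; [apply Cmod_ge_0|unfold A; lra]. }
  assert (Hlt : A * Cmod (w - z) < d).
  { apply Rmult_lt_compat_l with (r := A) in Hw; [|lra].
    replace (A * (d / A)) with d in Hw by (field; lra). exact Hw. }
  specialize (F (a * w + b)%C (Rle_lt_trans _ _ _ Hm Hlt)).
  replace (l * a * (w - z))%C with (l * (a * w + b - (a * z + b)))%C by ring.
  eapply Rle_trans; [exact F|].
  apply Rle_trans with (eps / A * (A * Cmod (w - z))).
  - apply Rmult_le_compat_l; [apply Rlt_le, Rdiv_lt_0_compat; lra|exact Hm].
  - right. field. lra.
Qed.

Lemma cderiv_inv (z : C) : z <> 0%C -> is_cderiv_at Cinv z (- (/ z * / z))%C.
Proof.
  intros Hz. assert (Hm : 0 < Cmod z) by (apply Cmod_gt_0; exact Hz).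
  apply cderiv_def. intros eps Heps. set (r := Cmod z) in *.
  (* The first radius keeps [Cmod w] above [r / 2]; within the second, the remainder
     [(w - z)^2 / (z^2 w)] is then at most [eps * Cmod (w - z)]. *)
  set (d := Rmin (r / 2) (eps * (r * r * (r / 2)))).
  exists d. split; [apply Rmin_pos; [lra|]; repeat apply Rmult_lt_0_compat; lra|].
  intros w Hw.
  assert (D1 : Cmod (w - z) < r / 2) by (eapply Rlt_le_trans; [exact Hw|apply Rmin_l]).
  assert (D2 : Cmod (w - z) < eps * (r * r * (r / 2))) by (eapply Rlt_le_trans; [exact Hw|apply Rmin_r]).
  assert (Hwr : r / 2 < Cmod w).
  { assert (H := Cmod_triangle (- (w - z)) w).
    replace (- (w - z) + w)%C with z in H by ring. rewrite Cmod_opp in H. fold r in H. lra. }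
  assert (Hw0 : w <> 0%C) by (apply Cmod_gt_0; lra).
  replace (/ w - / z - - (/ z * / z) * (w - z))%C with ((w - z) * (w - z) * / (z * z * w))%C
    by (field; auto).
  rewrite Cmod_mult, Cmod_inv, !Cmod_mult by (repeat apply Cmult_neq_0; auto). fold r.
  set (t := Cmod (w - z)) in *. assert (Ht : 0 <= t) by apply Cmod_ge_0.
  assert (Hp : r * r * (r / 2) <= r * r * Cmod w) by (apply Rmult_le_compat_l; nra).
  assert (Hq : 0 < r * r * (r / 2)) by (repeat apply Rmult_lt_0_compat; lra).
  apply Rmult_le_reg_r with (r * r * Cmod w); [lra|].
  replace (t * t * / (r * r * Cmod w) * (r * r * Cmod w)) with (t * t) by (field; lra).
  apply Rle_trans with (eps * (r * r * (r / 2)) * t); [apply Rmult_le_compat_r; lra|].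
  replace (eps * t * (r * r * Cmod w)) with (eps * (r * r * Cmod w) * t) by ring.
  apply Rmult_le_compat_r; [lra|]. apply Rmult_le_compat_l; lra.
Qed.

(** * Continuity at a point and along straight paths *)

Definition ccont (f : C -> C) (z : C) : Prop :=
  forall eps, 0 < eps -> exists del, 0 < del /\
    forall w : C, Cmod (w - z) < del -> Cmod (f w - f z) < eps.

Lemma cderiv_ccont (f : C -> C) (z l : C) : is_cderiv_at f z l -> ccont f z.
Proof.
  intros H eps Heps. destruct (cderiv_lip _ _ _ H) as [d [Hd F]].
  set (L := Cmod l + 1) in *. assert (HL : 1 <= L) by (generalize (Cmod_ge_0 l); unfold L; lra).
  exists (Rmin d (eps / L)); split; [apply Rmin_pos; [lra|apply Rdiv_lt_0_compat; lra]|].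
  intros w Hw. eapply Rle_lt_trans; [apply F; eapply Rlt_le_trans; [exact Hw|apply Rmin_l]|].
  assert (H2 : Cmod (w - z) < eps / L) by (eapply Rlt_le_trans; [exact Hw|apply Rmin_r]).
  apply Rmult_lt_compat_l with (r := L) in H2; [|lra].
  replace (L * (eps / L)) with eps in H2 by (field; lra). exact H2.
Qed.

Lemma ccont_mult (f g : C -> C) (z : C) : ccont f z -> ccont g z ->
  ccont (fun w => f w * g w)%C z.
Proof.
  intros Hf Hg eps Heps.
  set (A := Cmod (f z)). set (B := Cmod (g z)).
  assert (HA : 0 <= A) by apply Cmod_ge_0. assert (HB : 0 <= B) by apply Cmod_ge_0.
  set (e := Rmin 1 (eps / (A + B + 2))).
  assert (He : 0 < e) by (apply Rmin_pos; [lra|apply Rdiv_lt_0_compat; lra]).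
  assert (He1 : e <= 1) by apply Rmin_l.
  assert (He2 : e * (A + B + 2) <= eps).
  { apply Rle_trans with (eps / (A + B + 2) * (A + B + 2)); [|right; field; lra].
    apply Rmult_le_compat_r; [lra|apply Rmin_r]. }
  destruct (Hf e He) as [d1 [H1 F]]. destruct (Hg e He) as [d2 [H2 G]].
  exists (Rmin d1 d2); split; [apply Rmin_pos; lra|]. intros w Hw.
  specialize (F w (Rlt_le_trans _ _ _ Hw (Rmin_l _ _))).
  specialize (G w (Rlt_le_trans _ _ _ Hw (Rmin_r _ _))).
  replace (f w * g w - f z * g z)%C with
    ((f w - f z) * g z + f z * (g w - g z) + (f w - f z) * (g w - g z))%C by ring.
  eapply Rle_lt_trans; [apply Cmod_triangle|].
  eapply Rle_lt_trans; [apply Rplus_le_compat_r, Cmod_triangle|].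
  rewrite !Cmod_mult. fold A B.
  set (p := Cmod (f w - f z)) in *. set (q := Cmod (g w - g z)) in *.
  assert (0 <= p) by apply Cmod_ge_0. assert (0 <= q) by apply Cmod_ge_0.
  assert (p * B <= e * B) by (apply Rmult_le_compat_r; lra).
  assert (A * q <= A * e) by (apply Rmult_le_compat_l; lra).
  assert (p * q <= e * 1) by (apply Rmult_le_compat; lra).
  lra.
Qed.

Lemma fst_le_Cmod (z : C) : Rabs (fst z) <= Cmod z.
Proof. eapply Rle_trans; [apply Rmax_l|apply Rmax_Cmod]. Qed.

Lemma snd_le_Cmod (z : C) : Rabs (snd z) <= Cmod z.
Proof. eapply Rle_trans; [apply Rmax_r|apply Rmax_Cmod]. Qed.

Lemma Cmod_le_abs (z : C) : Cmod z <= Rabs (fst z) + Rabs (snd z).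
Proof.
  destruct z as [x y]; simpl.
  replace (x, y) with (RtoC x + Ci * RtoC y)%C
    by (unfold RtoC, Ci, Cplus, Cmult; simpl; f_equal; ring).
  eapply Rle_trans; [apply Cmod_triangle|].
  rewrite Cmod_mult, Cmod_Ci, !Cmod_R. lra.
Qed.

Lemma ccont_path (f : C -> C) (p : R -> C) (d : C) (t : R) :
  (forall s, p s = p t + RtoC (s - t) * d)%C -> ccont f (p t) ->
  continuous (fun s => fst (f (p s))) t /\ continuous (fun s => snd (f (p s))) t /\
  continuous (fun s => Cmod (f (p s))) t.
Proof.
  intros Hp Hf.
  assert (K : forall eps : posreal, locally t (fun s => Cmod (f (p s) - f (p t)) < eps)).
  { intros eps. destruct (Hf eps (cond_pos eps)) as [e [He F]].
    set (D := Cmod d + 1). assert (HD : 1 <= D) by (generalize (Cmod_ge_0 d); unfold D; lra).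
    assert (He' : 0 < e / D) by (apply Rdiv_lt_0_compat; lra).
    exists (mkposreal _ He'). intros s Hs. apply F. rewrite (Hp s).
    change (Rabs (s - t) < e / D) in Hs.
    replace (p t + RtoC (s - t) * d - p t)%C with (RtoC (s - t) * d)%C by ring.
    rewrite Cmod_mult, Cmod_R. apply Rmult_lt_compat_r with (r := D) in Hs; [|lra].
    replace (e / D * D) with e in Hs by (field; lra).
    eapply Rle_lt_trans; [|exact Hs]. apply Rmult_le_compat_l; [apply Rabs_pos|unfold D; lra]. }
  split; [|split]; apply filterlim_locally; intros eps; generalize (K eps); apply filter_imp;
    intros s Hs; eapply Rle_lt_trans; try exact Hs.
  - exact (fst_le_Cmod (f (p s) - f (p t))%C).
  - exact (snd_le_Cmod (f (p s) - f (p t))%C).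
  - change (Rabs (Cmod (f (p s)) - Cmod (f (p t))) <= Cmod (f (p s) - f (p t))).
    apply Rabs_le. split.
    + assert (H := Cmod_triangle (- (f (p s) - f (p t))) (f (p s))).
      replace (- (f (p s) - f (p t)) + f (p s))%C with (f (p t)) in H by ring.
      rewrite Cmod_opp in H. lra.
    + assert (H := Cmod_triangle (f (p s) - f (p t)) (f (p t))).
      replace (f (p s) - f (p t) + f (p t))%C with (f (p s)) in H by ring. lra.
Qed.

(** * Goursat's theorem on rectangles *)

Lemma RInt_sub (g h : R -> R) (a b : R) : ex_RInt g a b -> ex_RInt h a b ->
  ex_RInt (fun s => g s - h s) a b /\
  RInt (fun s => g s - h s) a b = RInt g a b - RInt h a b.
Proof.
  intros Hg Hh. split.
  - exact (ex_RInt_minus g h a b Hg Hh).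
  - exact (RInt_minus g h a b Hg Hh).
Qed.

Lemma RInt_near_const (g : R -> R) (a b k e : R) : a <= b -> ex_RInt g a b ->
  (forall s, a <= s <= b -> Rabs (g s - k) <= e) -> Rabs (RInt g a b - k * (b - a)) <= e * (b - a).
Proof.
  intros Hab Hg H.
  destruct (RInt_sub g (fun _ => k) a b Hg (ex_RInt_const a b k)) as [X1 X2].
  rewrite RInt_const in X2. change (scal (b - a) k) with ((b - a) * k) in X2.
  rewrite (Rmult_comm k), <- X2, (Rmult_comm e).
  apply abs_RInt_le_const; assumption.
Qed.

(** The real part of [(u + i v) (dx + i dy)] is [u dx - v dy], so horizontal sides involve only
    [fst] and vertical sides only [snd]. The imaginary part is never formed: [cauchy_estimate]
    rotates its integrand instead. *)
Definition hint (f : C -> C) (a b y : R) : R := RInt (fun s => fst (f (s, y))) a b.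
Definition vint (f : C -> C) (x c d : R) : R := RInt (fun s => snd (f (x, s))) c d.

(* The real part of the integral of [f dw] along the boundary of [[a,b] x [c,d]]. *)
Definition rect_int (f : C -> C) (a b c d : R) : R :=
  hint f a b c - hint f a b d - vint f b c d + vint f a c d.

Lemma ex_hint (f : C -> C) (a b y : R) : a <= b ->
  (forall s, a <= s <= b -> ccont f (s, y)) -> ex_RInt (fun s => fst (f (s, y))) a b.
Proof.
  intros Hab H. apply (ex_RInt_continuous (V := R_CompleteNormedModule)).
  rewrite Rmin_left, Rmax_right by lra. intros s Hs.
  apply (ccont_path f (fun s => (s, y)) (1, 0) s).
  - intros t. unfold Cplus, Cmult, RtoC; simpl. f_equal; ring.
  - apply H; exact Hs.
Qed.

Lemma ex_vint (f : C -> C) (x c d : R) : c <= d ->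
  (forall s, c <= s <= d -> ccont f (x, s)) -> ex_RInt (fun s => snd (f (x, s))) c d.
Proof.
  intros Hab H. apply (ex_RInt_continuous (V := R_CompleteNormedModule)).
  rewrite Rmin_left, Rmax_right by lra. intros s Hs.
  apply (ccont_path f (fun s => (x, s)) (0, 1) s).
  - intros t. unfold Cplus, Cmult, RtoC; simpl. f_equal; ring.
  - apply H; exact Hs.
Qed.

Lemma rect_int_split_h (f : C -> C) (a m b c d : R) : a <= m <= b ->
  (forall s, a <= s <= b -> ccont f (s, c)) -> (forall s, a <= s <= b -> ccont f (s, d)) ->
  rect_int f a b c d = rect_int f a m c d + rect_int f m b c d.
Proof.
  intros Hm Hc Hd.
  assert (K : forall y, (forall s, a <= s <= b -> ccont f (s, y)) ->
    hint f a m y + hint f m b y = hint f a b y).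
  { intros y Hy. apply (RInt_Chasles (V := R_CompleteNormedModule)); apply ex_hint;
      try lra; intros s Hs; apply Hy; lra. }
  unfold rect_int. rewrite <- (K c Hc), <- (K d Hd). ring.
Qed.

Lemma rect_int_split_v (f : C -> C) (a b c m d : R) : c <= m <= d ->
  (forall s, c <= s <= d -> ccont f (a, s)) -> (forall s, c <= s <= d -> ccont f (b, s)) ->
  rect_int f a b c d = rect_int f a b c m + rect_int f a b m d.
Proof.
  intros Hm Ha Hb.
  assert (K : forall x, (forall s, c <= s <= d -> ccont f (x, s)) ->
    vint f x c m + vint f x m d = vint f x c d).
  { intros y Hy. apply (RInt_Chasles (V := R_CompleteNormedModule)); apply ex_vint;
      try lra; intros s Hs; apply Hy; lra. }
  unfold rect_int. rewrite <- (K a Ha), <- (K b Hb). ring.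
Qed.

(** An affine function integrates to zero because its values on opposite sides differ by a constant:
    with [l = p + i q], both pairs of sides give [q (b - a) (d - c)], with opposite signs. The
    factor 2 counts the error on the two sides of a pair. *)
Lemma rect_int_near_affine (f : C -> C) (a b c d e : R) (z l : C) : a <= b -> c <= d ->
  (forall x y, a <= x <= b -> c <= y <= d -> ccont f (x, y)) ->
  (forall x y, a <= x <= b -> c <= y <= d -> Cmod (f (x, y) - f z - l * ((x, y) - z)) <= e) ->
  Rabs (rect_int f a b c d) <= 2 * e * ((b - a) + (d - c)).
Proof.
  intros Hab Hcd Hc He.
  destruct l as [p q]. destruct z as [x0 y0].
  assert (Hre : forall x y, a <= x <= b -> c <= y <= d ->
    Rabs (fst (f (x, y)) - fst (f (x0, y0)) - (p * (x - x0) - q * (y - y0))) <= e).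
  { intros x y Hx Hy. eapply Rle_trans; [|exact (He x y Hx Hy)].
    eapply Rle_trans; [|apply fst_le_Cmod]. right. reflexivity. }
  assert (Him : forall x y, a <= x <= b -> c <= y <= d ->
    Rabs (snd (f (x, y)) - snd (f (x0, y0)) - (p * (y - y0) + q * (x - x0))) <= e).
  { intros x y Hx Hy. eapply Rle_trans; [|exact (He x y Hx Hy)].
    eapply Rle_trans; [|apply snd_le_Cmod]. right. reflexivity. }
  assert (H1 : Rabs (hint f a b c - hint f a b d - q * (d - c) * (b - a)) <= 2 * e * (b - a)).
  { assert (X1 : ex_RInt (fun s => fst (f (s, c))) a b).
    { apply ex_hint; [exact Hab|]. intros; apply Hc; lra. }
    assert (X2 : ex_RInt (fun s => fst (f (s, d))) a b).
    { apply ex_hint; [exact Hab|]. intros; apply Hc; lra. }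
    destruct (RInt_sub _ _ _ _ X1 X2) as [X3 X4]. unfold hint. rewrite <- X4.
    apply RInt_near_const; [assumption|exact X3|].
    intros s Hs. assert (A := Hre s c Hs ltac:(lra)). assert (B := Hre s d Hs ltac:(lra)).
    apply Rabs_le_between in A. apply Rabs_le_between in B. apply Rabs_le_between. lra. }
  assert (H2 : Rabs (vint f b c d - vint f a c d - q * (b - a) * (d - c)) <= 2 * e * (d - c)).
  { assert (X1 : ex_RInt (fun s => snd (f (b, s))) c d).
    { apply ex_vint; [exact Hcd|]. intros; apply Hc; lra. }
    assert (X2 : ex_RInt (fun s => snd (f (a, s))) c d).
    { apply ex_vint; [exact Hcd|]. intros; apply Hc; lra. }
    destruct (RInt_sub _ _ _ _ X1 X2) as [X3 X4]. unfold vint. rewrite <- X4.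
    apply RInt_near_const; [assumption|exact X3|].
    intros s Hs. assert (A := Him b s ltac:(lra) Hs). assert (B := Him a s ltac:(lra) Hs).
    apply Rabs_le_between in A. apply Rabs_le_between in B. apply Rabs_le_between. lra. }
  unfold rect_int. apply Rabs_le_between in H1. apply Rabs_le_between in H2.
  apply Rabs_le_between. lra.
Qed.

Lemma nested_intervals (a b : nat -> R) :
  (forall n, a n <= a (S n)) -> (forall n, b (S n) <= b n) -> (forall n, a n <= b n) ->
  exists x, forall n, a n <= x <= b n.
Proof.
  intros Ha Hb Hab.
  assert (Ma : forall n k, a n <= a (n + k)%nat).
  { intros n k. induction k; [rewrite Nat.add_0_r; lra|]. rewrite Nat.add_succ_r.
    eapply Rle_trans; [exact IHk|apply Ha]. }
  assert (Mb : forall n k, b (n + k)%nat <= b n).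
  { intros n k. induction k; [rewrite Nat.add_0_r; lra|]. rewrite Nat.add_succ_r.
    eapply Rle_trans; [apply Hb|exact IHk]. }
  assert (U : forall n m, a n <= b m).
  { intros n m. apply Rle_trans with (a (n + m)%nat); [apply Ma|].
    apply Rle_trans with (b (n + m)%nat); [apply Hab|]. rewrite Nat.add_comm. apply Mb. }
  destruct (completeness (fun x => exists n, x = a n)) as [x [Hx1 Hx2]].
  - exists (b O). intros y [n ->]. apply U.
  - exists (a O). exists O. reflexivity.
  - exists x. intros n. split.
    + apply Hx1. exists n. reflexivity.
    + apply Hx2. intros y [m ->]. apply U.
Qed.

Lemma pow2_inv_small (S0 del : R) : 0 < del -> exists n, S0 / 2 ^ n < del.
Proof.
  intros Hd. destruct (pow_lt_1_zero (/ 2)) with (y := del / (Rabs S0 + 1)) as [N HN].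
  - rewrite Rabs_pos_eq; lra.
  - apply Rdiv_lt_0_compat; [lra|]. generalize (Rabs_pos S0); lra.
  - exists N. specialize (HN N (Nat.le_refl _)). rewrite Rabs_pos_eq in HN by (apply pow_le; lra).
    rewrite pow_inv in HN.
    assert (P : 0 < / 2 ^ N) by (apply Rinv_0_lt_compat, pow_lt; lra).
    assert (Q := Rabs_pos S0). assert (Q' := Rle_abs S0).
    apply Rmult_lt_compat_r with (r := Rabs S0 + 1) in HN; [|lra].
    replace (del / (Rabs S0 + 1) * (Rabs S0 + 1)) with del in HN by (field; lra).
    unfold Rdiv. nra.
Qed.

Definition rectangle := (R * R * R * R)%type.

Definition is_half (a b a' b' : R) : Prop :=
  (a' = a /\ b' = (a + b) / 2) \/ (a' = (a + b) / 2 /\ b' = b).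

(** Bisection. Each quarter has half the value of [(b - a) + (d - c)], hence a quarter of its
    square, so a violated bound [eta * ((b - a) + (d - c)) ^ 2] is inherited by some quarter. At the
    common point of the nested rectangles the affine approximation contradicts this. *)
Theorem goursat (f : C -> C) (a b c d : R) : a <= b -> c <= d ->
  (forall x y, a <= x <= b -> c <= y <= d -> exists l, is_cderiv_at f (x, y) l) ->
  rect_int f a b c d = 0.
Proof.
  intros Hab Hcd Hf.
  assert (Hc : forall x y, a <= x <= b -> c <= y <= d -> ccont f (x, y)).
  { intros x y Hx Hy. destruct (Hf x y Hx Hy) as [l Hl]. exact (cderiv_ccont _ _ _ Hl). }
  assert (Main : forall eta, 0 < eta ->
    Rabs (rect_int f a b c d) <= eta * ((b - a) + (d - c)) ^ 2).
  2:{ apply Rabs_eq_0. apply Rle_antisym; [|apply Rabs_pos].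
      apply Rnot_lt_le. intros Hpos.
      set (T := ((b - a) + (d - c)) ^ 2) in *.
      assert (HT : 0 <= T) by apply pow2_ge_0.
      assert (M := Main (Rabs (rect_int f a b c d) / (2 * (T + 1)))).
      set (A := Rabs (rect_int f a b c d)) in *.
      assert (P : 0 < A / (2 * (T + 1))) by (apply Rdiv_lt_0_compat; lra).
      specialize (M P).
      replace A with (A / (2 * (T + 1)) * (2 * (T + 1))) in M at 1 by (field; lra). nra. }
  intros eta Heta. apply Rnot_lt_le. intros Hbad0.
  set (bad := fun Q : rectangle => let '(a', b', c', d') := Q in
    a <= a' /\ a' <= b' /\ b' <= b /\ c <= c' /\ c' <= d' /\ d' <= d /\
    eta * ((b' - a') + (d' - c')) ^ 2 < Rabs (rect_int f a' b' c' d')).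
  set (quarter := fun Q Q' : rectangle => let '(a1, b1, c1, d1) := Q in
    let '(a2, b2, c2, d2) := Q' in is_half a1 b1 a2 b2 /\ is_half c1 d1 c2 d2).
  (* An arbitrary quarter is taken when [bad Q] fails, so that [next] is a total function and the
     sequence can be defined by plain recursion. *)
  assert (Step : forall Q, exists Q', quarter Q Q' /\ (bad Q -> bad Q')).
  { intros [[[a1 b1] c1] d1].
    destruct (classic (bad (a1, b1, c1, d1))) as [B|B].
    2:{ exists (a1, (a1 + b1) / 2, c1, (c1 + d1) / 2). split; [|tauto].
        split; left; auto. }
    destruct B as (B1 & B2 & B3 & B4 & B5 & B6 & B7).
    apply NNPP. intros HN.
    assert (Q : forall a2 b2 c2 d2, is_half a1 b1 a2 b2 -> is_half c1 d1 c2 d2 ->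
      Rabs (rect_int f a2 b2 c2 d2) <= eta * ((b1 - a1) + (d1 - c1)) ^ 2 / 4).
    { intros a2 b2 c2 d2 X1 X2. apply Rnot_lt_le. intros L. apply HN.
      exists (a2, b2, c2, d2). split; [split; assumption|]. intros _.
      unfold bad. unfold is_half in X1, X2.
      replace (b2 - a2) with ((b1 - a1) / 2) by (destruct X1; lra).
      replace (d2 - c2) with ((d1 - c1) / 2) by (destruct X2; lra).
      replace (((b1 - a1) / 2 + (d1 - c1) / 2) ^ 2) with ((b1 - a1 + (d1 - c1)) ^ 2 / 4) by field.
      replace (eta * ((b1 - a1 + (d1 - c1)) ^ 2 / 4)) with
        (eta * (b1 - a1 + (d1 - c1)) ^ 2 / 4) by field.
      destruct X1, X2; repeat split; lra. }
    set (m := (a1 + b1) / 2) in *. set (n := (c1 + d1) / 2) in *.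
    assert (Hm : a1 <= m <= b1) by (unfold m; lra).
    assert (Hn : c1 <= n <= d1) by (unfold n; lra).
    assert (HL : is_half a1 b1 a1 m) by (left; auto).
    assert (HR : is_half a1 b1 m b1) by (right; auto).
    assert (HD : is_half c1 d1 c1 n) by (left; auto).
    assert (HU : is_half c1 d1 n d1) by (right; auto).
    assert (Q1 := Q _ _ _ _ HL HD). assert (Q2 := Q _ _ _ _ HL HU).
    assert (Q3 := Q _ _ _ _ HR HD). assert (Q4 := Q _ _ _ _ HR HU).
    rewrite (rect_int_split_h f a1 m b1 c1 d1) in B7;
      [|exact Hm|intros; apply Hc; lra|intros; apply Hc; lra].
    rewrite (rect_int_split_v f a1 m c1 n d1) in B7;
      [|exact Hn|intros; apply Hc; lra|intros; apply Hc; lra].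
    rewrite (rect_int_split_v f m b1 c1 n d1) in B7;
      [|exact Hn|intros; apply Hc; lra|intros; apply Hc; lra].
    apply (Rlt_irrefl (eta * (b1 - a1 + (d1 - c1)) ^ 2)).
    eapply Rlt_le_trans; [exact B7|].
    eapply Rle_trans; [apply Rabs_triang|].
    eapply Rle_trans; [apply Rplus_le_compat; apply Rabs_triang|]. lra. }
  set (next := fun Q => proj1_sig (constructive_indefinite_description _ (Step Q))).
  assert (Hnext : forall Q, quarter Q (next Q) /\ (bad Q -> bad (next Q))).
  { intros Q. unfold next. apply proj2_sig. }
  set (seq := fix seq n := match n with O => (a, b, c, d) | S n => next (seq n) end).
  assert (Hbad : forall n, bad (seq n)).
  { induction n; [simpl; repeat split; lra|]. exact (proj2 (Hnext (seq n)) IHn). }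
  set (sa := fun n => fst (fst (fst (seq n)))). set (sb := fun n => snd (fst (fst (seq n)))).
  set (sc := fun n => snd (fst (seq n))). set (sd := fun n => snd (seq n)).
  assert (Hseq : forall n, seq n = (sa n, sb n, sc n, sd n)).
  { intros n. unfold sa, sb, sc, sd. destruct (seq n) as [[[? ?] ?] ?]. reflexivity. }
  assert (Hhalf : forall n, is_half (sa n) (sb n) (sa (S n)) (sb (S n)) /\
    is_half (sc n) (sd n) (sc (S n)) (sd (S n))).
  { intros n. assert (K := proj1 (Hnext (seq n))). change (next (seq n)) with (seq (S n)) in K.
    rewrite (Hseq n), (Hseq (S n)) in K. exact K. }
  assert (Hb : forall n, bad (sa n, sb n, sc n, sd n)).
  { intros n. rewrite <- Hseq. apply Hbad. }
  assert (Hlen : forall n, (sb n - sa n) + (sd n - sc n) = ((b - a) + (d - c)) / 2 ^ n).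
  { induction n; [simpl; unfold sa, sb, sc, sd; simpl; field|].
    destruct (Hhalf n) as [X1 X2]. unfold is_half in *.
    assert (P : 2 ^ n <> 0) by (apply pow_nonzero; lra).
    replace ((b - a + (d - c)) / 2 ^ S n) with ((b - a + (d - c)) / 2 ^ n / 2)
      by (simpl; field; auto).
    rewrite <- IHn. destruct X1, X2; lra. }
  destruct (nested_intervals sa sb) as [x Hx].
  { intros n. destruct (Hhalf n) as [X _]. destruct (Hb n) as (? & ? & ?).
    unfold is_half in X. destruct X; lra. }
  { intros n. destruct (Hhalf n) as [X _]. destruct (Hb n) as (? & ? & ?).
    unfold is_half in X. destruct X; lra. }
  { intros n. apply Hb. }
  destruct (nested_intervals sc sd) as [y Hy].
  { intros n. destruct (Hhalf n) as [_ X]. destruct (Hb n) as (? & ? & ? & ? & ? & ?).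
    unfold is_half in X. destruct X; lra. }
  { intros n. destruct (Hhalf n) as [_ X]. destruct (Hb n) as (? & ? & ? & ? & ? & ?).
    unfold is_half in X. destruct X; lra. }
  { intros n. apply Hb. }
  destruct (Hf x y (Hx O) (Hy O)) as [l Hl].
  (* [eta / 2] compensates for the factor 2 in [rect_int_near_affine]. *)
  destruct (proj1 (cderiv_def f (x, y) l) Hl (eta / 2)) as [del [Hdel Hw]]; [lra|].
  destruct (pow2_inv_small ((b - a) + (d - c)) del Hdel) as [n Hn].
  destruct (Hb n) as (B1 & B2 & B3 & B4 & B5 & B6 & B7).
  specialize (Hx n). specialize (Hy n). rewrite <- Hlen in Hn.
  set (s := (sb n - sa n) + (sd n - sc n)) in *.
  apply (Rlt_irrefl (eta * s ^ 2)). eapply Rlt_le_trans; [exact B7|].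
  replace (eta * s ^ 2) with (2 * (eta / 2 * s) * s) by (simpl; field).
  apply (rect_int_near_affine f (sa n) (sb n) (sc n) (sd n) (eta / 2 * s) (x, y) l);
    [assumption..| |].
  - intros; apply Hc; lra.
  - intros x' y' Hx' Hy'.
    assert (D : Cmod ((x', y') - (x, y)) <= s).
    { eapply Rle_trans; [apply Cmod_le_abs|]. simpl. unfold s.
      apply Rplus_le_compat; apply Rabs_le_between; lra. }
    eapply Rle_trans; [apply Hw; lra|]. apply Rmult_le_compat_l; lra.
Qed.

(** * Cauchy's estimate *)

Lemma Cmod_fst_ge (z : C) (r : R) : r <= Rabs (fst z) -> r <= Cmod z.
Proof. intros H. eapply Rle_trans; [exact H|apply fst_le_Cmod]. Qed.

Lemma Cmod_snd_ge (z : C) (r : R) : r <= Rabs (snd z) -> r <= Cmod z.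
Proof. intros H. eapply Rle_trans; [exact H|apply snd_le_Cmod]. Qed.

Definition in_square (z : C) (r : R) (w : C) : Prop :=
  Rabs (fst w - fst z) <= r /\ Rabs (snd w - snd z) <= r.

(** The frame between the squares is cut into a left and a right strip and the pieces below and
    above the inner square. None contains the centre, so [goursat] makes all four vanish. *)
Lemma rect_int_square_shrink (k : C -> C) (x y r e : R) : 0 < e <= r ->
  (forall w, in_square (x, y) r w -> w <> (x, y) -> exists l, is_cderiv_at k w l) ->
  rect_int k (x - r) (x + r) (y - r) (y + r) = rect_int k (x - e) (x + e) (y - e) (y + e).
Proof.
  intros He Hk.
  assert (D : forall x' y', x - r <= x' <= x + r -> y - r <= y' <= y + r ->
    (e <= Rabs (x' - x) \/ e <= Rabs (y' - y)) -> exists l, is_cderiv_at k (x', y') l).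
  { intros x' y' Hx Hy Hd. apply Hk.
    - split; simpl; apply Rabs_le_between; lra.
    - intros E. injection E as -> ->. rewrite !Rminus_diag, Rabs_R0 in Hd. lra. }
  assert (Cc : forall x' y', x - r <= x' <= x + r -> y - r <= y' <= y + r ->
    (e <= Rabs (x' - x) \/ e <= Rabs (y' - y)) -> ccont k (x', y')).
  { intros x' y' Hx Hy Hd. destruct (D x' y' Hx Hy Hd) as [l Hl].
    exact (cderiv_ccont _ _ _ Hl). }
  assert (AL : forall t s, t <= s - e -> e <= Rabs (t - s)).
  { intros t s H. rewrite Rabs_minus_sym, Rabs_pos_eq; lra. }
  assert (AR : forall t s, s + e <= t -> e <= Rabs (t - s)).
  { intros t s H. rewrite Rabs_pos_eq; lra. }
  rewrite (rect_int_split_h k (x - r) (x - e) (x + r)) by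
    (first [lra | intros; apply Cc; [lra|lra|right; first [apply AL; lra|apply AR; lra]]]).
  rewrite (rect_int_split_h k (x - e) (x + e) (x + r)) by
    (first [lra | intros; apply Cc; [lra|lra|right; first [apply AL; lra|apply AR; lra]]]).
  rewrite (rect_int_split_v k (x - e) (x + e) (y - r) (y - e) (y + r)) by
    (first [lra | intros; apply Cc; [lra|lra|left; first [apply AL; lra|apply AR; lra]]]).
  rewrite (rect_int_split_v k (x - e) (x + e) (y - e) (y + e) (y + r)) by
    (first [lra | intros; apply Cc; [lra|lra|left; first [apply AL; lra|apply AR; lra]]]).
  rewrite (goursat k (x - r) (x - e)) by
    (first [lra | intros; apply D; [lra|lra|left; apply AL; lra]]).
  rewrite (goursat k (x + e) (x + r)) by
    (first [lra | intros; apply D; [lra|lra|left; apply AR; lra]]).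
  rewrite (goursat k (x - e) (x + e) (y - r)) by
    (first [lra | intros; apply D; [lra|lra|right; apply AL; lra]]).
  rewrite (goursat k (x - e) (x + e) (y + e)) by
    (first [lra | intros; apply D; [lra|lra|right; apply AR; lra]]).
  lra.
Qed.

Lemma RInt_le_const (g : R -> R) (a b k : R) : a <= b -> ex_RInt g a b ->
  (forall s, a <= s <= b -> g s <= k) -> RInt g a b <= (b - a) * k.
Proof.
  intros Hab Hg H. replace ((b - a) * k) with (RInt (fun _ => k) a b).
  - apply RInt_le; [exact Hab|exact Hg|apply ex_RInt_const|]. intros; apply H; lra.
  - rewrite RInt_const. reflexivity.
Qed.

Lemma RInt_ge_const (g : R -> R) (a b k : R) : a <= b -> ex_RInt g a b ->
  (forall s, a <= s <= b -> k <= g s) -> (b - a) * k <= RInt g a b.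
Proof.
  intros Hab Hg H. replace ((b - a) * k) with (RInt (fun _ => k) a b).
  - apply RInt_le; [exact Hab|apply ex_RInt_const|exact Hg|]. intros; apply H; lra.
  - rewrite RInt_const. reflexivity.
Qed.

(** The bounds are one-sided, with the sign with which each side enters [rect_int]: in
    [cauchy_estimate] the pole contributes with a definite sign on every side, which a bound on the
    modulus would lose. The perimeter is [8 * r]. *)
Lemma rect_int_square_le (k : C -> C) (x y r q : R) : 0 <= r ->
  (forall s, - r <= s <= r -> ccont k (x + s, y - r) /\ ccont k (x + s, y + r) /\
    ccont k (x + r, y + s) /\ ccont k (x - r, y + s)) ->
  (forall s, - r <= s <= r -> fst (k (x + s, y - r)) <= q /\ - q <= fst (k (x + s, y + r)) /\
    - q <= snd (k (x + r, y + s)) /\ snd (k (x - r, y + s)) <= q) ->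
  rect_int k (x - r) (x + r) (y - r) (y + r) <= 8 * r * q.
Proof.
  intros Hr Hc Hq. unfold rect_int.
  assert (Sx : forall s, s = x + (s - x)) by (intros; ring).
  assert (Sy : forall s, s = y + (s - y)) by (intros; ring).
  assert (I1 : hint k (x - r) (x + r) (y - r) <= (x + r - (x - r)) * q).
  { apply RInt_le_const; [lra| |].
    - apply ex_hint; [lra|]. intros s Hs. rewrite (Sx s). apply Hc. lra.
    - intros s Hs. rewrite (Sx s). apply Hq. lra. }
  assert (I2 : (x + r - (x - r)) * (- q) <= hint k (x - r) (x + r) (y + r)).
  { apply RInt_ge_const; [lra| |].
    - apply ex_hint; [lra|]. intros s Hs. rewrite (Sx s). apply Hc. lra.
    - intros s Hs. rewrite (Sx s). apply Hq. lra. }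
  assert (I3 : (y + r - (y - r)) * (- q) <= vint k (x + r) (y - r) (y + r)).
  { apply RInt_ge_const; [lra| |].
    - apply ex_vint; [lra|]. intros s Hs. rewrite (Sy s). apply Hc. lra.
    - intros s Hs. rewrite (Sy s). apply Hq. lra. }
  assert (I4 : vint k (x - r) (y - r) (y + r) <= (y + r - (y - r)) * q).
  { apply RInt_le_const; [lra| |].
    - apply ex_vint; [lra|]. intros s Hs. rewrite (Sy s). apply Hc. lra.
    - intros s Hs. rewrite (Sy s). apply Hq. lra. }
  lra.
Qed.

Lemma rect_int_square_opp (k : C -> C) (x y r : R) : 0 <= r ->
  (forall s, - r <= s <= r -> ccont k (x + s, y - r) /\ ccont k (x + s, y + r) /\
    ccont k (x + r, y + s) /\ ccont k (x - r, y + s)) ->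
  rect_int (fun w => - k w)%C (x - r) (x + r) (y - r) (y + r) =
  - rect_int k (x - r) (x + r) (y - r) (y + r).
Proof.
  intros Hr Hc.
  assert (Sx : forall s, s = x + (s - x)) by (intros; ring).
  assert (Sy : forall s, s = y + (s - y)) by (intros; ring).
  assert (I1 : hint (fun w => - k w)%C (x - r) (x + r) (y - r) = - hint k (x - r) (x + r) (y - r)).
  { apply (RInt_opp (V := R_CompleteNormedModule) (fun s => fst (k (s, y - r)))).
    apply ex_hint; [lra|]. intros s Hs. rewrite (Sx s). apply Hc. lra. }
  assert (I2 : hint (fun w => - k w)%C (x - r) (x + r) (y + r) = - hint k (x - r) (x + r) (y + r)).
  { apply (RInt_opp (V := R_CompleteNormedModule) (fun s => fst (k (s, y + r)))).
    apply ex_hint; [lra|]. intros s Hs. rewrite (Sx s). apply Hc. lra. }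
  assert (I3 : vint (fun w => - k w)%C (x + r) (y - r) (y + r) = - vint k (x + r) (y - r) (y + r)).
  { apply (RInt_opp (V := R_CompleteNormedModule) (fun s => snd (k (x + r, s)))).
    apply ex_vint; [lra|]. intros s Hs. rewrite (Sy s). apply Hc. lra. }
  assert (I4 : vint (fun w => - k w)%C (x - r) (y - r) (y + r) = - vint k (x - r) (y - r) (y + r)).
  { apply (RInt_opp (V := R_CompleteNormedModule) (fun s => snd (k (x - r, s)))).
    apply ex_vint; [lra|]. intros s Hs. rewrite (Sy s). apply Hc. lra. }
  unfold rect_int. rewrite I1, I2, I3, I4. ring.
Qed.

Lemma Cminus_neq_0 (z w : C) : z <> w -> (z - w)%C <> 0%C.
Proof.
  intros H E. apply H. replace z with (z - w + w)%C by ring. rewrite E. ring.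
Qed.

(** On the given square the integrand is a term of modulus at most [2 * M / r ^ 2] plus a multiple
    of [1 / (w - z)]. The former contributes at most [16 * M / r]; the latter, whose exact
    contribution would be [- 2 * PI * L], is only shown to contribute at most [- 4 * L]. As the
    total is nonnegative, the constant is 4. *)
Lemma cauchy_estimate (f : C -> C) (z l : C) (r M : R) : 0 < r ->
  (forall w, in_square z r w -> exists l, is_cderiv_at f w l) ->
  (forall w, in_square z r w -> Cmod (f w) <= M) ->
  is_cderiv_at f z l -> Cmod l <= 4 * M / r.
Proof.
  intros Hr Hd HM Hl.
  assert (Hzz : in_square z r z) by (split; rewrite Rminus_diag, Rabs_R0; lra).
  assert (HM0 : 0 <= M) by (eapply Rle_trans; [apply Cmod_ge_0|exact (HM z Hzz)]).
  destruct (Req_dec (Cmod l) 0) as [L0|L0].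
  { rewrite L0. apply Rmult_le_pos; [lra|]. apply Rlt_le, Rinv_0_lt_compat, Hr. }
  set (L := Cmod l) in *. assert (HL : 0 < L) by (generalize (Cmod_ge_0 l); fold L; lra).
  assert (Hl0 : l <> 0%C) by (apply Cmod_gt_0; exact HL).
  (* [mu] rotates [f'(z)] so that the residue term contributes to the real part. *)
  set (mu := ((0%R, (- L)%R) * / l)%C : C).
  assert (Hmul : (mu * l)%C = (0, - L)) by (unfold mu; field; exact Hl0).
  assert (Hmu : Cmod mu = 1).
  { unfold mu. rewrite Cmod_mult, Cmod_inv by exact Hl0. fold L.
    replace ((0%R, (- L)%R) : C) with (RtoC (- L) * Ci)%C
      by (unfold RtoC, Ci, Cmult; simpl; f_equal; ring).
    rewrite Cmod_mult, Cmod_Ci, Cmod_R, Rabs_Ropp, Rabs_pos_eq by lra. field. lra. }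
  set (k := fun w : C => (mu * (f w - f z - l * (w - z)) * (/ (w - z) * / (w - z)))%C).
  destruct z as [x y].
  assert (Hkd : forall w, in_square (x, y) r w -> w <> (x, y) -> exists l, is_cderiv_at k w l).
  { intros w Hw Hne. destruct (Hd w Hw) as [lw Hlw]. eexists. unfold k.
    apply (cderiv_ext (fun w => mu * (f w + (- l * w + (l * (x, y) - f (x, y)))) *
      (/ (1 * w + - (x, y)) * / (1 * w + - (x, y))))%C).
    { intros v. replace (1 * v + - (x, y))%C with (v - (x, y))%C by ring. f_equal. f_equal. ring. }
    assert (Hne' : (1 * w + - (x, y))%C <> 0%C).
    { replace (1 * w + - (x, y))%C with (w - (x, y))%C by ring. apply Cminus_neq_0, Hne. }
    assert (Di := cderiv_affine Cinv 1 (- (x, y))%C w _ (cderiv_inv _ Hne')).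
    apply cderiv_mult; [|apply cderiv_mult; exact Di].
    apply cderiv_mult; [apply cderiv_const|].
    apply cderiv_plus; [exact Hlw|].
    apply cderiv_plus; [|apply cderiv_const].
    apply cderiv_mult; [apply cderiv_const|apply cderiv_id]. }
  assert (Hcont : forall e s, 0 < e <= r -> - e <= s <= e ->
    ccont k (x + s, y - e) /\ ccont k (x + s, y + e) /\
    ccont k (x + e, y + s) /\ ccont k (x - e, y + s)).
  { assert (K : forall x' y', Rabs (x' - x) <= r -> Rabs (y' - y) <= r ->
      (x' <> x \/ y' <> y) -> ccont k (x', y')).
    { intros x' y' H1 H2 H3. destruct (Hkd (x', y')) as [m Hm].
      - split; assumption.
      - intros E; injection E as -> ->. destruct H3; lra.
      - exact (cderiv_ccont _ _ _ Hm). }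
    intros e s He Hs.
    repeat split; apply K; try (apply Rabs_le_between; lra);
      first [left; lra | right; lra]. }
  (* Only this half of the vanishing of the integral is needed. It is an upper bound for [- k],
     which is what [rect_int_square_le] provides: on the square of half-side [e] the integrand is at
     most [eta / e], and the perimeter is [8 * e]. *)
  assert (E0 : 0 <= rect_int k (x - r) (x + r) (y - r) (y + r)).
  { assert (P : forall eta, 0 < eta -> - rect_int k (x - r) (x + r) (y - r) (y + r) <= 8 * eta).
    { intros eta Heta.
      destruct (proj1 (cderiv_def f (x, y) l) Hl eta Heta) as [del [Hdel Hw]].
      (* Points of the square of half-side [e] lie within [2 * e < del] of the centre. *)
      set (e := Rmin r (del / 3)).
      assert (He : 0 < e <= r) by (split; [apply Rmin_pos; lra|apply Rmin_l]).
      assert (Hed : e <= del / 3) by apply Rmin_r.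
      rewrite (rect_int_square_shrink k x y r e He Hkd).
      assert (B : forall w : C, e <= Cmod (w - (x, y)) -> Cmod (w - (x, y)) < del ->
        Cmod (k w) <= eta / e).
      { intros w Hw1 Hw2. specialize (Hw w Hw2). unfold k.
        assert (Hne : (w - (x, y))%C <> 0%C) by (apply Cmod_gt_0; lra).
        rewrite !Cmod_mult, Hmu, Cmod_inv by exact Hne.
        set (t := Cmod (w - (x, y))) in *.
        apply Rle_trans with (eta * t * (/ t * / t)).
        - rewrite Rmult_1_l. apply Rmult_le_compat_r; [|exact Hw].
          apply Rlt_le, Rmult_lt_0_compat; apply Rinv_0_lt_compat; lra.
        - replace (eta * t * (/ t * / t)) with (eta * / t) by (field; lra).
          apply Rmult_le_compat_l; [lra|]. apply Rinv_le_contravar; lra. }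
      assert (B1 : forall s, - e <= s <= e -> Cmod (k (x + s, y - e)) <= eta / e /\
         Cmod (k (x + s, y + e)) <= eta / e /\ Cmod (k (x + e, y + s)) <= eta / e /\
         Cmod (k (x - e, y + s)) <= eta / e).
      { intros s Hs. assert (As : Rabs s <= e) by (apply Rabs_le_between; lra).
        assert (Ae : Rabs e = e) by (apply Rabs_pos_eq; lra).
        repeat split; apply B;
          [apply Cmod_snd_ge| |apply Cmod_snd_ge| |apply Cmod_fst_ge| |apply Cmod_fst_ge|];
          try (eapply Rle_lt_trans; [apply Cmod_le_abs|]);
          unfold Cminus, Cplus, Copp; cbn [fst snd];
          replace (x + s + - x) with s by ring; replace (y + s + - y) with s by ring;
          try replace (y - e + - y) with (- e) by ring; try replace (y + e + - y) with e by ring;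
          try replace (x - e + - x) with (- e) by ring; try replace (x + e + - x) with e by ring;
          rewrite ?Rabs_Ropp, ?Ae; lra. }
      assert (Q := rect_int_square_le (fun w => - k w)%C x y e (eta / e)).
      assert (N : rect_int (fun w => - k w)%C (x - e) (x + e) (y - e) (y + e) =
        - rect_int k (x - e) (x + e) (y - e) (y + e)).
      { apply rect_int_square_opp; [lra|]. intros s Hs. apply Hcont; lra. }
      rewrite N in Q.
      replace (8 * eta) with (8 * e * (eta / e)) by (field; lra). apply Q; [lra| |].
      - intros s Hs. destruct (Hcont e s He Hs) as (C1 & C2 & C3 & C4).
        assert (Cn : forall w, ccont k w -> ccont (fun w => - k w)%C w).
        { intros w Hk ep Hep. destruct (Hk ep Hep) as [d [X1 X2]]. exists d; split; [exact X1|].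
          intros v Hv. specialize (X2 v Hv). rewrite <- Cmod_opp.
          replace (- (- k v - - k w))%C with (k v - k w)%C by ring. exact X2. }
        auto.
      - intros s Hs. destruct (B1 s Hs) as (C1 & C2 & C3 & C4).
        assert (Fb : forall w, Cmod (k w) <= eta / e -> - (eta / e) <= fst (k w) <= eta / e).
        { intros w Hk. apply Rabs_le_between. eapply Rle_trans; [apply fst_le_Cmod|exact Hk]. }
        assert (Sb : forall w, Cmod (k w) <= eta / e -> - (eta / e) <= snd (k w) <= eta / e).
        { intros w Hk. apply Rabs_le_between. eapply Rle_trans; [apply snd_le_Cmod|exact Hk]. }
        apply Fb in C1. apply Fb in C2. apply Sb in C3. apply Sb in C4.
        clearbody k. unfold Copp; cbn [fst snd]. lra. }
    set (E := rect_int k (x - r) (x + r) (y - r) (y + r)) in *.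
    apply Rnot_lt_le. intros Hneg. specialize (P (- E / 16)). lra. }
  assert (F : forall w, in_square (x, y) r w -> r <= Cmod (w - (x, y)) ->
    let t := (fst w - x) ^ 2 + (snd w - y) ^ 2 in
    Rabs (fst (k w) - L * (snd w - y) / t) <= 2 * M / r ^ 2 /\
    Rabs (snd (k w) - L * (fst w - x) / t) <= 2 * M / r ^ 2).
  { intros w Hw Hwr t.
    assert (Hne : (w - (x, y))%C <> 0%C) by (apply Cmod_gt_0; lra).
    assert (Ek : k w = (mu * (f w - f (x, y)) * (/ (w - (x, y)) * / (w - (x, y))) +
      (0, L) * / (w - (x, y)))%C).
    { replace ((0, L) : C) with (- (mu * l))%C by
        (rewrite Hmul; unfold Copp; simpl; f_equal; ring).
      unfold k. field. exact Hne. }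
    assert (Bk : Cmod (mu * (f w - f (x, y)) * (/ (w - (x, y)) * / (w - (x, y)))) <= 2 * M / r ^ 2).
    { rewrite !Cmod_mult, Hmu, Cmod_inv by exact Hne. rewrite Rmult_1_l.
      assert (Hi : / Cmod (w - (x, y)) <= / r) by (apply Rinv_le_contravar; lra).
      assert (Hi0 : 0 < / Cmod (w - (x, y))) by (apply Rinv_0_lt_compat; lra).
      replace (2 * M / r ^ 2) with ((2 * M) * (/ r * / r)) by (field; lra).
      apply Rmult_le_compat; try apply Cmod_ge_0; [nra| |apply Rmult_le_compat; lra].
      eapply Rle_trans; [apply Cmod_triangle|]. rewrite Cmod_opp.
      generalize (HM w Hw) (HM (x, y) Hzz). lra. }
    set (k1 := (mu * (f w - f (x, y)) * (/ (w - (x, y)) * / (w - (x, y))))%C) in *.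
    assert (Et : ((0, L) * / (w - (x, y)))%C = (L * (snd w - y) / t, L * (fst w - x) / t)).
    { destruct w as [a b]. unfold t. unfold Cinv, Cminus, Cplus, Copp, Cmult; cbn [fst snd].
      f_equal; unfold Rminus, Rdiv; ring. }
    rewrite Ek, Et. unfold Cplus; cbn [fst snd].
    split; [match goal with |- Rabs ?X <= _ => replace X with (fst k1) by ring end
           |match goal with |- Rabs ?X <= _ => replace X with (snd k1) by ring end];
      (eapply Rle_trans; [|exact Bk]); [apply fst_le_Cmod|apply snd_le_Cmod]. }
  (* On a side [s ^ 2 + r ^ 2 <= 2 * r ^ 2], so the pole term has size at least [L / (2 * r)] there,
     and on all four sides it lowers the integral. *)
  assert (U : rect_int k (x - r) (x + r) (y - r) (y + r) <= 8 * r * (2 * M / r ^ 2 - L / (2 * r))).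
  { apply rect_int_square_le; [lra| |].
    - intros s Hs. apply Hcont; lra.
    - intros s Hs.
      assert (Hsr : 0 < s ^ 2 + r ^ 2) by nra.
      assert (T : L / (2 * r) <= L * r / (s ^ 2 + r ^ 2)).
      { apply Rmult_le_reg_r with (2 * r * (s ^ 2 + r ^ 2)); [nra|].
        replace (L / (2 * r) * (2 * r * (s ^ 2 + r ^ 2))) with (L * (s ^ 2 + r ^ 2)) by (field; lra).
        replace (L * r / (s ^ 2 + r ^ 2) * (2 * r * (s ^ 2 + r ^ 2))) with (L * (2 * r ^ 2))
          by (field; lra).
        apply Rmult_le_compat_l; [lra|]. nra. }
      assert (Ar : Rabs r = r) by (apply Rabs_pos_eq; lra).
      assert (X : forall x' y', Rabs (x' - x) <= r -> Rabs (y' - y) <= r ->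
        (r <= Rabs (x' - x) \/ r <= Rabs (y' - y)) ->
        in_square (x, y) r (x', y') /\ r <= Cmod ((x', y') - (x, y))).
      { intros x' y' H1 H2 H3. split; [split; assumption|].
        destruct H3; [apply Cmod_fst_ge|apply Cmod_snd_ge]; assumption. }
      assert (As : Rabs s <= r) by (apply Rabs_le_between; lra).
      assert (X1 : x + s - x = s) by ring. assert (X2 : y + s - y = s) by ring.
      assert (X3 : x + r - x = r) by ring. assert (X4 : y + r - y = r) by ring.
      assert (X5 : x - r - x = - r) by ring. assert (X6 : y - r - y = - r) by ring.
      assert (Y1 : in_square (x, y) r (x + s, y - r) /\ r <= Cmod ((x + s, y - r) - (x, y))).
      { apply X; rewrite ?X1, ?X6, ?Rabs_Ropp, ?Ar; lra. }
      assert (Y2 : in_square (x, y) r (x + s, y + r) /\ r <= Cmod ((x + s, y + r) - (x, y))).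
      { apply X; rewrite ?X1, ?X4, ?Rabs_Ropp, ?Ar; lra. }
      assert (Y3 : in_square (x, y) r (x + r, y + s) /\ r <= Cmod ((x + r, y + s) - (x, y))).
      { apply X; rewrite ?X2, ?X3, ?Rabs_Ropp, ?Ar; lra. }
      assert (Y4 : in_square (x, y) r (x - r, y + s) /\ r <= Cmod ((x - r, y + s) - (x, y))).
      { apply X; rewrite ?X2, ?X5, ?Rabs_Ropp, ?Ar; lra. }
      destruct (F _ (proj1 Y1) (proj2 Y1)) as [Z1 _].
      destruct (F _ (proj1 Y2) (proj2 Y2)) as [Z2 _].
      destruct (F _ (proj1 Y3) (proj2 Y3)) as [_ Z3].
      destruct (F _ (proj1 Y4) (proj2 Y4)) as [_ Z4].
      cbn [fst snd] in Z1, Z2, Z3, Z4.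
      rewrite X1, X6 in Z1. rewrite X1, X4 in Z2. rewrite X3, X2 in Z3. rewrite X5, X2 in Z4.
      replace ((- r) ^ 2) with (r ^ 2) in Z1, Z4 by ring.
      rewrite (Rplus_comm (r ^ 2)) in Z3. rewrite (Rplus_comm (r ^ 2)) in Z4.
      replace (L * - r / (s ^ 2 + r ^ 2)) with (- (L * r / (s ^ 2 + r ^ 2))) in Z1, Z4 by (field; lra).
      apply Rabs_le_between in Z1. apply Rabs_le_between in Z2.
      apply Rabs_le_between in Z3. apply Rabs_le_between in Z4. lra. }
  assert (V : 0 <= 8 * r * (2 * M / r ^ 2 - L / (2 * r))) by lra.
  replace (8 * r * (2 * M / r ^ 2 - L / (2 * r))) with (4 * (4 * M / r - L)) in V by (field; lra).
  lra.
Qed.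

(** * Growth and continuity of the derivative *)

Lemma cderiv_path (f : C -> C) (p : R -> C) (d l : C) (t : R) :
  (forall s, p s = p t + RtoC (s - t) * d)%C -> is_cderiv_at f (p t) l ->
  is_derive (fun s => fst (f (p s))) t (fst (l * d)%C) /\
  is_derive (fun s => snd (f (p s))) t (snd (l * d)%C).
Proof.
  intros Hp Hf.
  assert (K : forall eps, 0 < eps -> exists del : posreal, forall h : R, h <> 0 -> Rabs h < del ->
    Cmod (f (p (t + h)%R) - f (p t) - RtoC h * (l * d)) < eps * Rabs h).
  { intros eps He. set (D := Cmod d + 1).
    assert (HD : 1 <= D) by (generalize (Cmod_ge_0 d); unfold D; lra).
    destruct (proj1 (cderiv_def f (p t) l) Hf (eps / (2 * D))) as [e [He' F]];
      [apply Rdiv_lt_0_compat; lra|].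
    assert (Hd : 0 < e / D) by (apply Rdiv_lt_0_compat; lra).
    exists (mkposreal _ Hd). intros h Hh Hhd. simpl in Hhd.
    assert (E : (p (t + h)%R - p t)%C = (RtoC h * d)%C).
    { rewrite (Hp (t + h)%R). replace (t + h - t) with h by ring. ring. }
    specialize (F (p (t + h)%R)). rewrite E, Cmod_mult, Cmod_R in F.
    assert (Hle : Rabs h * Cmod d <= Rabs h * D)
      by (apply Rmult_le_compat_l; [apply Rabs_pos|unfold D; lra]).
    replace (l * (RtoC h * d))%C with (RtoC h * (l * d))%C in F by ring.
    assert (Hlt : Rabs h * D < e).
    { apply Rmult_lt_compat_r with (r := D) in Hhd; [|lra].
      replace (e / D * D) with e in Hhd by (field; lra). exact Hhd. }
    eapply Rle_lt_trans; [apply F; lra|].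
    apply Rle_lt_trans with (eps / (2 * D) * (Rabs h * D)).
    - apply Rmult_le_compat_l; [apply Rlt_le, Rdiv_lt_0_compat; lra|exact Hle].
    - replace (eps / (2 * D) * (Rabs h * D)) with (eps * Rabs h / 2) by (field; lra).
      assert (0 < eps * Rabs h) by (apply Rmult_lt_0_compat; [lra|apply Rabs_pos_lt, Hh]). lra. }
  assert (Q : forall (phi : R -> R) m, (forall h : R, Rabs (phi (t + h) - phi t - h * m) <=
     Cmod (f (p (t + h)%R) - f (p t) - RtoC h * (l * d))) -> is_derive phi t m).
  { intros phi m H. apply is_derive_Reals. intros eps He.
    destruct (K eps He) as [del Hdel]. exists del. intros h Hh Hhd.
    replace ((phi (t + h) - phi t) / h - m) with ((phi (t + h) - phi t - h * m) * / h)
      by (field; exact Hh).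
    assert (P : 0 < Rabs h) by (apply Rabs_pos_lt, Hh).
    rewrite Rabs_mult, Rabs_inv. apply Rmult_lt_reg_r with (Rabs h); [exact P|].
    rewrite Rmult_assoc, Rinv_l, Rmult_1_r by lra.
    eapply Rle_lt_trans; [apply H|apply Hdel; assumption]. }
  split; apply Q; intros h.
  - eapply Rle_trans; [|apply fst_le_Cmod]. right. f_equal.
    unfold Cminus, Cplus, Copp, Cmult, RtoC; cbn [fst snd]. ring.
  - eapply Rle_trans; [|apply snd_le_Cmod]. right. f_equal.
    unfold Cminus, Cplus, Copp, Cmult, RtoC; cbn [fst snd]. ring.
Qed.

Lemma mean_value_ineq (phi dphi : R -> R) (a b B : R) :
  (forall t, Rmin a b <= t <= Rmax a b -> is_derive phi t (dphi t)) ->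
  (forall t, Rmin a b <= t <= Rmax a b -> Rabs (dphi t) <= B) ->
  Rabs (phi b - phi a) <= B * Rabs (b - a).
Proof.
  intros Hd HB. destruct (MVT_gen phi a b dphi) as [c [Hc E]].
  - intros t Ht. apply Hd. lra.
  - intros t Ht. apply derivable_continuous_pt. exists (dphi t).
    apply is_derive_Reals, Hd, Ht.
  - rewrite E, Rabs_mult. apply Rmult_le_compat_r; [apply Rabs_pos|apply HB, Hc].
Qed.

(** The factor 2 comes from applying the real mean value theorem to the two coordinates
    separately. *)
Lemma cderiv_lipschitz (f f' : C -> C) (w h : C) (B : R) :
  (forall t, 0 <= t <= 1 -> is_cderiv_at f (w + RtoC t * h)%C (f' (w + RtoC t * h)%C)) ->
  (forall t, 0 <= t <= 1 -> Cmod (f' (w + RtoC t * h)%C) <= B) ->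
  Cmod (f (w + h)%C - f w) <= 2 * B * Cmod h.
Proof.
  intros Hd HB. set (p := fun t => (w + RtoC t * h)%C).
  assert (Hp : forall t s, p s = (p t + RtoC (s - t) * h)%C).
  { intros t s. unfold p. rewrite RtoC_minus. ring. }
  assert (P1 : (w + h)%C = p 1) by (unfold p; ring).
  assert (P0 : w = p 0) by (unfold p; ring).
  assert (Bd : forall t, 0 <= t <= 1 -> Cmod (f' (p t) * h) <= B * Cmod h).
  { intros t Ht. rewrite Cmod_mult. apply Rmult_le_compat_r; [apply Cmod_ge_0|exact (HB t Ht)]. }
  assert (K1 : Rabs (fst (f (p 1)) - fst (f (p 0))) <= B * Cmod h * Rabs (1 - 0)).
  { apply mean_value_ineq with (phi := fun t => fst (f (p t))) (dphi := fun t => fst (f' (p t) * h)%C);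
      rewrite Rmin_left, Rmax_right by lra; intros t Ht.
    - exact (proj1 (cderiv_path f p h _ t (Hp t) (Hd t Ht))).
    - eapply Rle_trans; [apply fst_le_Cmod|apply Bd, Ht]. }
  assert (K2 : Rabs (snd (f (p 1)) - snd (f (p 0))) <= B * Cmod h * Rabs (1 - 0)).
  { apply mean_value_ineq with (phi := fun t => snd (f (p t))) (dphi := fun t => snd (f' (p t) * h)%C);
      rewrite Rmin_left, Rmax_right by lra; intros t Ht.
    - exact (proj2 (cderiv_path f p h _ t (Hp t) (Hd t Ht))).
    - eapply Rle_trans; [apply snd_le_Cmod|apply Bd, Ht]. }
  rewrite P1. replace (f w) with (f (p 0)) by (rewrite <- P0; reflexivity).
  eapply Rle_trans; [apply Cmod_le_abs|].
  rewrite Rminus_0_r, Rabs_R1 in K1, K2.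
  unfold Cminus, Cplus, Copp; cbn [fst snd]. unfold Rminus in K1, K2. lra.
Qed.

Lemma in_square_Cmod (z : C) (r : R) (w : C) : in_square z r w -> Cmod (w - z) <= 2 * r.
Proof.
  intros [H1 H2]. eapply Rle_trans; [apply Cmod_le_abs|].
  unfold Cminus, Cplus, Copp; cbn [fst snd]. unfold Rminus in H1, H2. lra.
Qed.

(* The Cauchy estimate for the increments [w |-> f (w + h) - f w], which are
   [O(h)], bounds the increments of [f']. *)
Lemma cderiv_bounded_continuous (f f' : C -> C) (z : C) (r B : R) : 0 < r ->
  (forall v, Cmod (v - z) < r -> is_cderiv_at f v (f' v)) ->
  (forall v, Cmod (v - z) < r -> Cmod (f' v) <= B) -> ccont f' z.
Proof.
  intros Hr Hd HB.
  assert (Hz : Cmod (z - z) < r).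
  { replace (z - z)%C with (RtoC 0) by ring. rewrite Cmod_0. exact Hr. }
  assert (HB0 : 0 <= B) by (eapply Rle_trans; [apply Cmod_ge_0|exact (HB z Hz)]).
  (* Points of this square, at distance at most [r / 3] from [z], stay within [r / 2] of [z] after a
     shift shorter than [r / 6]. *)
  set (q := r / 6).
  assert (K : forall h, Cmod h < r / 6 -> Cmod (f' (z + h)%C - f' z) <= 8 * B / q * Cmod h).
  { intros h Hh.
    assert (Hs : forall w t, in_square z q w -> 0 <= t <= 1 ->
      Cmod (w + RtoC t * h - z) < r).
    { intros w t Hw Ht. apply in_square_Cmod in Hw.
      replace (w + RtoC t * h - z)%C with ((w - z) + RtoC t * h)%C by ring.
      eapply Rle_lt_trans; [apply Cmod_triangle|]. rewrite Cmod_mult, Cmod_R.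
      rewrite Rabs_pos_eq by lra.
      assert (t * Cmod h <= 1 * Cmod h) by (apply Rmult_le_compat_r; [apply Cmod_ge_0|lra]).
      unfold q in Hw. lra. }
    assert (Der : forall w, in_square z q w ->
      is_cderiv_at (fun w => f (1 * w + h) + (- (1)) * f w)%C w
        (f' (w + h) * 1 + (0 * f w + - (1) * f' w))%C).
    { intros w Hw. apply cderiv_plus.
      - apply cderiv_affine. replace (1 * w + h)%C with (w + h)%C by ring.
        apply Hd. assert (X := Hs w 1 Hw ltac:(lra)).
        replace (w + RtoC 1 * h)%C with (w + h)%C in X by ring. exact X.
      - apply (cderiv_mult (fun _ => - (1))%C); [apply cderiv_const|].
        apply Hd. assert (X := Hs w 0 Hw ltac:(lra)).
        replace (w + RtoC 0 * h)%C with w in X by ring. exact X. }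
    assert (Hzq : in_square z q z) by (split; rewrite Rminus_diag, Rabs_R0; unfold q; lra).
    assert (CE := cauchy_estimate (fun w => f (1 * w + h) + (- (1)) * f w)%C z
      (f' (z + h) * 1 + (0 * f z + - (1) * f' z))%C q
      (2 * B * Cmod h) ltac:(unfold q; lra)
      (fun w Hw => ex_intro _ _ (Der w Hw))).
    replace (f' (z + h) - f' z)%C with (f' (z + h) * 1 + (0 * f z + - (1) * f' z))%C by ring.
    replace (8 * B / q * Cmod h) with (4 * (2 * B * Cmod h) / q) by (unfold q; field; lra).
    apply CE; [|apply Der, Hzq]. intros w Hw.
    replace (f (1 * w + h) + - (1) * f w)%C with (f (w + h) - f w)%C
      by (replace (1 * w + h)%C with (w + h)%C by ring; ring).
    apply cderiv_lipschitz with f'; intros t Ht; [apply Hd|apply HB]; apply Hs; assumption. }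
  intros eps Heps. set (A := 8 * B / q + 1).
  assert (HA : 1 <= A).
  { assert (0 <= 8 * B / q); [|unfold A; lra].
    apply Rmult_le_pos; [lra|apply Rlt_le, Rinv_0_lt_compat; unfold q; lra]. }
  exists (Rmin (r / 6) (eps / A)); split; [apply Rmin_pos; [lra|apply Rdiv_lt_0_compat; lra]|].
  intros w Hw.
  assert (H1 := K (w - z)%C (Rlt_le_trans _ _ _ Hw (Rmin_l _ _))).
  assert (H2 := Rlt_le_trans _ _ _ Hw (Rmin_r _ _)).
  replace (z + (w - z))%C with w in H1 by ring.
  eapply Rle_lt_trans; [exact H1|].
  apply Rmult_lt_compat_l with (r := A) in H2; [|lra].
  replace (A * (eps / A)) with eps in H2 by (field; lra).
  assert (0 <= Cmod (w - z)) by apply Cmod_ge_0. unfold A in H2. lra.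
Qed.

Lemma Rpower_pos (x a : R) : 0 < Rpower x a.
Proof. apply exp_pos. Qed.

Lemma Rpower_1_base (a : R) : Rpower 1 a = 1.
Proof. unfold Rpower. rewrite ln_1, Rmult_0_r. apply exp_0. Qed.

Lemma Rpower_le_1 (x a : R) : 0 < x <= 1 -> 0 <= a -> Rpower x a <= 1.
Proof. intros Hx Ha. rewrite <- (Rpower_1_base a). apply Rle_Rpower_l; assumption. Qed.

Lemma growth_deriv (alpha M : R) (f f' : C -> C) : 0 <= alpha -> deriv_D f f' ->
  (forall z, in_D z -> Rpower (1 - Cnorm z ^ 2) alpha * Cnorm (f z) <= M) ->
  forall z : C, Cmod z < 1 ->
    Cmod (f' z) <= 32 / Rpower (/ 4) alpha * M / Rpower (1 - Cmod z ^ 2) (alpha + 1).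
Proof.
  intros Ha Hd HM z Hz.
  set (t := Cmod z) in *. assert (Ht : 0 <= t) by apply Cmod_ge_0.
  set (X := 1 - t ^ 2). assert (HX : 0 < X) by (unfold X; nra).
  assert (HM0 : 0 <= M).
  { eapply Rle_trans; [|exact (HM z Hz)]. apply Rmult_le_pos; [apply Rlt_le, Rpower_pos|apply Cmod_ge_0]. }
  (* This square reaches modulus at most [(1 + t) / 2], where [1 - |w|^2] is still at least [X / 4];
     hence the factor [Rpower (/ 4) alpha]. As [X <= 2 * (1 - t)], dividing by [q] costs at most
     [8 / X], and 32 is 8 times the 4 of [cauchy_estimate]. *)
  set (q := (1 - t) / 4).
  assert (Hw : forall w, in_square z q w -> Cmod w <= (1 + t) / 2).
  { intros w Hw. apply in_square_Cmod in Hw.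
    replace w with ((w - z) + z)%C by ring. eapply Rle_trans; [apply Cmod_triangle|].
    fold t. unfold q in Hw. lra. }
  assert (CE : Cmod (f' z) <= 4 * (M / Rpower (X / 4) alpha) / q).
  { apply cauchy_estimate with f z; [unfold q; lra| | |apply Hd; exact Hz].
    - intros w Hsq. specialize (Hw w Hsq). exists (f' w). apply Hd. unfold in_D.
      change (Cmod w < 1). lra.
    - intros w Hsq. specialize (Hw w Hsq).
      assert (Hw0 : 0 <= Cmod w) by apply Cmod_ge_0.
      assert (Hw1 : Cmod w < 1) by lra.
      specialize (HM w Hw1). change (Cnorm w) with (Cmod w) in HM.
      change (Cnorm (f w)) with (Cmod (f w)) in HM.
      assert (HXw : X / 4 <= 1 - Cmod w ^ 2) by (unfold X; nra).
      apply Rmult_le_reg_l with (Rpower (X / 4) alpha); [apply Rpower_pos|].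
      replace (Rpower (X / 4) alpha * (M / Rpower (X / 4) alpha)) with M
        by (field; apply Rgt_not_eq, Rpower_pos).
      eapply Rle_trans; [|exact HM]. apply Rmult_le_compat_r; [apply Cmod_ge_0|].
      apply Rle_Rpower_l; lra. }
  eapply Rle_trans; [exact CE|].
  assert (E : Rpower (X / 4) alpha = Rpower X alpha * Rpower (/ 4) alpha).
  { rewrite Rpower_mult_distr by lra. reflexivity. }
  rewrite E, Rpower_plus, Rpower_1 by exact HX.
  assert (Pa := Rpower_pos X alpha). assert (Pb := Rpower_pos (/ 4) alpha).
  set (A := Rpower X alpha) in *. set (B := Rpower (/ 4) alpha) in *.
  replace (4 * (M / (A * B)) / q) with (M * 4 / (A * B) * / q) by (unfold q; field; lra).
  replace (32 / B * M / (A * X)) with (M * 4 / (A * B) * / (X / 8)) by (field; lra).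
  apply Rmult_le_compat_l.
  - apply Rmult_le_pos; [lra|]. apply Rlt_le, Rinv_0_lt_compat. nra.
  - apply Rinv_le_contravar; [lra|]. unfold X, q. nra.
Qed.

(** This ensures that the integrals in [Sg] exist. The growth estimate supplies the local bound on
    [f'] required by [cderiv_bounded_continuous]. *)
Lemma growth_deriv_continuous (alpha M : R) (f f' : C -> C) : 0 <= alpha -> deriv_D f f' ->
  (forall z, in_D z -> Rpower (1 - Cnorm z ^ 2) alpha * Cnorm (f z) <= M) ->
  forall z : C, Cmod z < 1 -> ccont f' z.
Proof.
  intros Ha Hd HM z Hz.
  assert (HM0 : 0 <= M).
  { eapply Rle_trans; [|exact (HM z Hz)]. apply Rmult_le_pos; [apply Rlt_le, Rpower_pos|apply Cmod_ge_0]. }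
  assert (G := growth_deriv alpha M f f' Ha Hd HM).
  set (t := Cmod z) in *. assert (Ht : 0 <= t) by apply Cmod_ge_0.
  set (T := (1 + t) / 2).
  assert (Hv : forall v, Cmod (v - z) < (1 - t) / 2 -> Cmod v <= T).
  { intros v Hv. replace v with ((v - z) + z)%C by ring.
    eapply Rle_trans; [apply Cmod_triangle|]. fold t. unfold T. lra. }
  assert (HT : T < 1) by (unfold T; lra).
  apply (cderiv_bounded_continuous f f' z ((1 - t) / 2)
    (32 / Rpower (/ 4) alpha * M / Rpower (1 - T ^ 2) (alpha + 1))); [lra| |].
  - intros v Hvz. apply Hd. change (Cmod v < 1). specialize (Hv v Hvz). lra.
  - intros v Hvz. specialize (Hv v Hvz). assert (Hv0 := Cmod_ge_0 v).
    eapply Rle_trans; [apply G; lra|]. apply Rmult_le_compat_l.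
    + apply Rmult_le_pos; [|exact HM0]. apply Rlt_le, Rdiv_lt_0_compat; [lra|apply Rpower_pos].
    + apply Rinv_le_contravar; [apply Rpower_pos|]. apply Rle_Rpower_l; [lra|]. nra.
Qed.

(** * Radial integrals and sufficiency *)

(** Once one integrability proof exists, [epsilon] returns the integral for some such proof, and the
    value does not depend on which. *)
Lemma Defs_RInt_eq (f : R -> R) (a b : R) : ex_RInt f a b -> Defs.RInt f a b = RInt f a b.
Proof.
  intros H. set (pr := ex_RInt_Reals_0 f a b H).
  assert (E : exists I, exists pr : Riemann_integrable f a b, RiemannInt pr = I)
    by (exists (RiemannInt pr), pr; reflexivity).
  destruct (epsilon_spec (inhabits 0) _ E) as [pr' Hpr'].
  unfold Defs.RInt. rewrite <- Hpr'. symmetry. apply RInt_Reals.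
Qed.

Lemma Cmod_polar (r theta : R) : Cmod (polar r theta) = Rabs r.
Proof.
  unfold polar, Cmod; cbn [fst snd].
  replace ((r * cos theta) ^ 2 + (r * sin theta) ^ 2) with (Rsqr r).
  - apply sqrt_Rsqr_abs.
  - assert (H := sin2_cos2 theta). unfold Rsqr in *.
    replace ((r * cos theta) ^ 2 + (r * sin theta) ^ 2)
      with (r * r * (sin theta * sin theta + cos theta * cos theta)) by ring.
    rewrite H. ring.
Qed.

Lemma polar_exists (z : C) : exists theta, 0 <= theta < 2 * PI /\ z = polar (Cmod z) theta.
Proof.
  set (t := Cmod z).
  assert (Ht : t * t = fst z ^ 2 + snd z ^ 2).
  { unfold t, Cmod. apply sqrt_sqrt. nra. }
  assert (Ht0 : 0 <= t) by apply Cmod_ge_0.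
  assert (HPI := PI_RGT_0).
  destruct (Req_dec t 0) as [E|E].
  { exists 0. split; [lra|]. assert (Z : z = 0%C) by (apply Cmod_eq_0; exact E).
    rewrite E, Z. unfold polar, RtoC. f_equal; ring. }
  set (x := fst z / t). set (y := snd z / t).
  assert (Hx : fst z = t * x) by (unfold x; field; exact E).
  assert (Hy : snd z = t * y) by (unfold y; field; exact E).
  assert (Hxy : x ^ 2 + y ^ 2 = 1).
  { rewrite Hx, Hy in Ht. apply Rmult_eq_reg_l with (t * t); [|nra].
    rewrite Rmult_1_r. rewrite Ht at 2. ring. }
  assert (Hx1 : -1 <= x <= 1) by nra.
  assert (Hs := sin_acos x Hx1). assert (Hc := cos_acos x Hx1). assert (Hb := acos_bound x).
  assert (Hsq : Rsqr y = 1 - Rsqr x) by (unfold Rsqr; lra).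
  rewrite <- Hsq, sqrt_Rsqr_abs in Hs.
  assert (Hz : z = (t * x, t * y)) by (rewrite <- Hx, <- Hy; apply surjective_pairing).
  destruct (Rle_or_lt 0 y) as [Y|Y].
  - exists (acos x). split; [lra|]. unfold polar.
    rewrite Hc, Hs, Rabs_pos_eq by exact Y. exact Hz.
  - exists (- acos x + 2 * PI). split.
    + split; [lra|]. destruct (Req_dec (acos x) 0) as [A|A]; [|lra].
      rewrite A, sin_0 in Hs. apply eq_sym, Rabs_eq_0 in Hs. lra.
    + unfold polar. replace (- acos x + 2 * PI) with (- acos x + 2 * INR 1 * PI) by (simpl; ring).
      rewrite cos_period, sin_period, cos_neg, sin_neg, Hc, Hs, Rabs_left by exact Y.
      rewrite Ropp_involutive. exact Hz.
Qed.

Definition radial_weight (alpha : R) (g : C -> C) (theta r : R) : R :=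
  Cmod (g (polar r theta)) / Rpower (1 - r ^ 2) (alpha + 1).

Lemma holo_ccont_polar (g : C -> C) (theta : R) (Hg : holo_D g) (r : R) :
  -1 < r < 1 -> ccont g (polar r theta).
Proof.
  intros Hr. destruct (Hg (polar r theta)) as [l Hl].
  - change (Cmod (polar r theta) < 1). rewrite Cmod_polar. apply Rabs_def1; lra.
  - exact (cderiv_ccont _ _ _ Hl).
Qed.

Lemma polar_path (theta r s : R) : polar s theta = (polar r theta + RtoC (s - r) * polar 1 theta)%C.
Proof. unfold polar, Cplus, Cmult, RtoC; cbn [fst snd]. f_equal; ring. Qed.

Lemma radial_weight_continuous (alpha : R) (g : C -> C) (theta : R) (Hg : holo_D g) (r : R) :
  -1 < r < 1 -> continuous (radial_weight alpha g theta) r.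
Proof.
  intros Hr. unfold radial_weight, Rdiv.
  apply (continuous_mult (K := R_AbsRing)).
  - apply (ccont_path g (fun r => polar r theta) (polar 1 theta) r (polar_path theta r)).
    apply (holo_ccont_polar g theta Hg), Hr.
  - apply (ex_derive_continuous (V := R_NormedModule)). unfold Rpower. auto_derive.
    repeat split; [nra|]. apply Rgt_not_eq, exp_pos.
Qed.

Lemma radial_weight_pos (alpha : R) (g : C -> C) (theta r : R) : 0 <= radial_weight alpha g theta r.
Proof.
  apply Rmult_le_pos; [apply Cmod_ge_0|]. apply Rlt_le, Rinv_0_lt_compat, Rpower_pos.
Qed.

Lemma ex_radial_weight (alpha : R) (g : C -> C) (theta : R) (Hg : holo_D g) (a b : R) :
  -1 < a <= b -> b < 1 -> ex_RInt (radial_weight alpha g theta) a b.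
Proof.
  intros Ha Hb. apply (ex_RInt_continuous (V := R_CompleteNormedModule)).
  rewrite Rmin_left, Rmax_right by lra. intros r Hr. apply (radial_weight_continuous alpha g theta Hg). lra.
Qed.

Lemma Phi_eq (alpha : R) (g : C -> C) (theta : R) (Hg : holo_D g) (beta t : R) : 0 <= t < 1 ->
  Phi alpha beta g t theta = Rpower (1 - t ^ 2) beta * RInt (radial_weight alpha g theta) 0 t.
Proof.
  intros Ht. unfold Phi. f_equal. apply Defs_RInt_eq. apply (ex_radial_weight alpha g theta Hg); lra.
Qed.

(** The substitution [r = t * s] passes between [Sg], parametrized over [[0, 1]], and [Phi], an
    integral over [[0, t]]. The [+ 0] is left from the affine substitution rule. *)
Lemma radial_weight_rescale (alpha : R) (g : C -> C) (theta : R) (Hg : holo_D g) (t c : R) :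
  0 <= t < 1 ->
  ex_RInt (fun s => c * (t * radial_weight alpha g theta (t * s + 0))) 0 1 /\
  RInt (fun s => c * (t * radial_weight alpha g theta (t * s + 0))) 0 1 =
    c * RInt (radial_weight alpha g theta) 0 t.
Proof.
  intros Ht.
  assert (E0 : t * 0 + 0 = 0) by ring. assert (E1 : t * 1 + 0 = t) by ring.
  assert (X : ex_RInt (radial_weight alpha g theta) (t * 0 + 0) (t * 1 + 0)).
  { rewrite E0, E1. apply (ex_radial_weight alpha g theta Hg); lra. }
  assert (Y := ex_RInt_comp_lin (radial_weight alpha g theta) t 0 0 1 X).
  split; [exact (ex_RInt_scal _ 0 1 c Y)|].
  assert (Z := RInt_comp_lin (radial_weight alpha g theta) t 0 0 1 X). rewrite E0, E1 in Z.
  rewrite <- Z. exact (RInt_scal _ 0 1 c Y).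
Qed.

Lemma Sg_radial (g : C -> C) (theta : R) (Hg : holo_D g) (f' : C -> C) (t : R) : 0 <= t < 1 ->
  (forall s, 0 <= s <= 1 -> ccont f' (polar (t * s) theta)) ->
  let F := fun s => (f' (polar (t * s) theta) * g (polar (t * s) theta) * polar t theta)%C in
  ex_RInt (fun s => fst (F s)) 0 1 /\ ex_RInt (fun s => snd (F s)) 0 1 /\
  Sg g f' (polar t theta) = (RInt (fun s => fst (F s)) 0 1, RInt (fun s => snd (F s)) 0 1).
Proof.
  intros Ht Hf F.
  assert (Hp : forall s, Cscale s (polar t theta) = polar (t * s) theta).
  { intros s. unfold Cscale, polar; cbn [fst snd]. f_equal; ring. }
  assert (K : forall s, 0 <= s <= 1 ->
    continuous (fun s => fst (F s)) s /\ continuous (fun s => snd (F s)) s).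
  { intros s Hs.
    destruct (ccont_path (fun w => f' w * g w * polar t theta)%C (fun s => polar (t * s) theta)
      (polar t theta) s) as (K1 & K2 & _).
    - intros s'. rewrite (polar_path theta (t * s)). unfold polar, Cplus, Cmult, RtoC; cbn [fst snd].
      f_equal; ring.
    - apply ccont_mult; [apply ccont_mult|].
      + apply Hf, Hs.
      + apply (holo_ccont_polar g theta Hg). nra.
      + exact (cderiv_ccont _ _ _ (cderiv_const (polar t theta) _)).
    - split; [exact K1|exact K2]. }
  assert (X1 : ex_RInt (fun s => fst (F s)) 0 1).
  { apply (ex_RInt_continuous (V := R_CompleteNormedModule)).
    rewrite Rmin_left, Rmax_right by lra. intros s Hs. apply K, Hs. }
  assert (X2 : ex_RInt (fun s => snd (F s)) 0 1).
  { apply (ex_RInt_continuous (V := R_CompleteNormedModule)).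
    rewrite Rmin_left, Rmax_right by lra. intros s Hs. apply K, Hs. }
  split; [exact X1|]. split; [exact X2|].
  unfold Sg.
  assert (E : forall s, Cmul (Cmul (f' (Cscale s (polar t theta))) (g (Cscale s (polar t theta))))
    (polar t theta) = F s) by (intros s; rewrite Hp; reflexivity).
  assert (E1 : ex_RInt (fun s => fst (Cmul (Cmul (f' (Cscale s (polar t theta)))
     (g (Cscale s (polar t theta)))) (polar t theta))) 0 1).
  { apply ex_RInt_ext with (fun s => fst (F s)); [|exact X1]. intros s _. rewrite E. reflexivity. }
  assert (E2 : ex_RInt (fun s => snd (Cmul (Cmul (f' (Cscale s (polar t theta)))
     (g (Cscale s (polar t theta)))) (polar t theta))) 0 1).
  { apply ex_RInt_ext with (fun s => snd (F s)); [|exact X2]. intros s _. rewrite E. reflexivity. }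
  cbv zeta. rewrite (Defs_RInt_eq _ _ _ E1), (Defs_RInt_eq _ _ _ E2).
  apply injective_projections; cbn [fst snd]; apply RInt_ext; intros s _; rewrite E; reflexivity.
Qed.


Lemma RInt_abs_le (f h : R -> R) (a b : R) : a <= b -> ex_RInt f a b -> ex_RInt h a b ->
  (forall s, a <= s <= b -> Rabs (f s) <= h s) -> Rabs (RInt f a b) <= RInt h a b.
Proof.
  intros Hab Hf Hh H. apply Rabs_le. split.
  - rewrite <- (RInt_opp (V := R_CompleteNormedModule) h a b Hh) at 1.
    apply RInt_le; [exact Hab|exact (ex_RInt_opp h a b Hh)|exact Hf|].
    intros s Hs. specialize (H s ltac:(lra)). apply Rabs_le_between in H.
    change (- h s <= f s). lra.
  - apply RInt_le; [exact Hab|exact Hf|exact Hh|].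
    intros s Hs. specialize (H s ltac:(lra)). apply Rabs_le_between in H. lra.
Qed.

(** The limsup concerns only [t] near 1, whereas boundedness concerns all [t]. The integral
    increases with [t], so its value at a single [t1] beyond [t0] controls all smaller [t],
    uniformly in [theta]. *)
Lemma limsup_finite_bound (alpha beta : R) (g : C -> C) : 0 <= beta -> holo_D g ->
  limsup_finite alpha beta g ->
  exists K, 0 <= K /\ forall t theta, 0 <= t < 1 -> 0 <= theta < 2 * PI ->
    Rpower (1 - t ^ 2) beta * RInt (radial_weight alpha g theta) 0 t <= K.
Proof.
  intros Hb Hg (M & t0 & Ht0 & HM).
  set (t1 := (t0 + 1) / 2). assert (Ht1 : t0 < t1 < 1) by (unfold t1; lra).
  set (A := Rpower (1 - t1 ^ 2) beta). assert (HA : 0 < A) by apply Rpower_pos.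
  exists (Rmax (Rmax M 0) (M / A)).
  split; [eapply Rle_trans; [|apply Rmax_l]; apply Rmax_r|].
  intros t theta Ht Hth.
  destruct (Rlt_or_le t0 t) as [H|H].
  - eapply Rle_trans; [|apply Rmax_l]. eapply Rle_trans; [|apply Rmax_l].
    rewrite <- Phi_eq by (auto; lra). apply HM; lra.
  - eapply Rle_trans; [|apply Rmax_r].
    assert (X := HM t1 Ht1 theta Hth). rewrite Phi_eq in X by (auto; lra). fold A in X.
    assert (I1 : 0 <= RInt (radial_weight alpha g theta) 0 t).
    { apply RInt_ge_0; [lra|apply ex_radial_weight; auto; lra|].
      intros; apply radial_weight_pos. }
    assert (I2 : RInt (radial_weight alpha g theta) 0 t <= RInt (radial_weight alpha g theta) 0 t1).
    { rewrite <- (RInt_Chasles (radial_weight alpha g theta) 0 t t1)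
        by (apply ex_radial_weight; auto; lra).
      assert (0 <= RInt (radial_weight alpha g theta) t t1).
      { apply RInt_ge_0; [lra|apply ex_radial_weight; auto; lra|].
        intros; apply radial_weight_pos. }
      unfold plus; simpl. lra. }
    apply Rle_trans with (RInt (radial_weight alpha g theta) 0 t1).
    + assert (P : Rpower (1 - t ^ 2) beta <= 1) by (apply Rpower_le_1; [nra|exact Hb]).
      assert (P0 := Rpower_pos (1 - t ^ 2) beta). nra.
    + apply Rmult_le_reg_l with A; [exact HA|].
      replace (A * (M / A)) with M by (field; lra). exact X.
Qed.

Lemma Sg_bounded_of_limsup_finite (alpha beta : R) (g : C -> C) :
  0 < alpha -> 0 <= beta -> holo_D g -> limsup_finite alpha beta g -> Sg_bounded alpha beta g.
Proof.
  intros Ha Hb Hg HL. destruct (limsup_finite_bound alpha beta g Hb Hg HL) as (K & HK0 & HK).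
  set (c := 32 / Rpower (/ 4) alpha).
  assert (Hc : 0 < c) by (apply Rdiv_lt_0_compat; [lra|apply Rpower_pos]).
  (* [c] is the constant of [growth_deriv]; the 2 comes from bounding a modulus by the sum of the
     coordinates. *)
  exists (2 * c * K). intros f f' Hd M HM z Hz.
  assert (HM0 : 0 <= M).
  { eapply Rle_trans; [|exact (HM z Hz)]. apply Rmult_le_pos; [apply Rlt_le, Rpower_pos|apply Cmod_ge_0]. }
  change (Cnorm z) with (Cmod z). change (Cmod z < 1) in Hz.
  change (Cnorm (Sg g f' z)) with (Cmod (Sg g f' z)).
  destruct (polar_exists z) as [theta [Hth E]]. set (t := Cmod z) in *.
  assert (Ht : 0 <= t < 1) by (split; [apply Cmod_ge_0|exact Hz]).
  rewrite E.
  assert (Hpt : forall s, 0 <= s <= 1 -> Cmod (polar (t * s) theta) = t * s /\ 0 <= t * s < 1).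
  { intros s Hs. assert (0 <= t * s < 1) by nra. rewrite Cmod_polar, Rabs_pos_eq by lra. auto. }
  destruct (Sg_radial g theta Hg f' t Ht) as (X1 & X2 & ->).
  { intros s Hs. destruct (Hpt s Hs) as [E1 E2].
    apply (growth_deriv_continuous alpha M f f'); [lra|exact Hd|exact HM|rewrite E1; lra]. }
  set (F := fun s => (f' (polar (t * s) theta) * g (polar (t * s) theta) * polar t theta)%C) in *.
  destruct (radial_weight_rescale alpha g theta Hg t (c * M) Ht) as [Y1 Y2].
  assert (Bd : forall s, 0 <= s <= 1 ->
    Cmod (F s) <= c * M * (t * radial_weight alpha g theta (t * s + 0))).
  { intros s Hs. destruct (Hpt s Hs) as [E1 E2]. unfold F, radial_weight.
    rewrite Rplus_0_r, !Cmod_mult.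
    assert (G := growth_deriv alpha M f f' ltac:(lra) Hd HM (polar (t * s) theta) ltac:(rewrite E1; lra)).
    rewrite E1 in G. fold c in G.
    rewrite (Cmod_polar t), (Rabs_pos_eq t) by lra.
    set (P := Rpower (1 - (t * s) ^ 2) (alpha + 1)) in *. set (N := Cmod (g _)).
    assert (HN : 0 <= N) by apply Cmod_ge_0.
    apply Rle_trans with (c * M / P * N * t); [|right; unfold Rdiv; ring].
    apply Rmult_le_compat_r; [lra|]. apply Rmult_le_compat_r; [exact HN|exact G]. }
  assert (I1 : Rabs (RInt (fun s => fst (F s)) 0 1) <= c * M * RInt (radial_weight alpha g theta) 0 t).
  { rewrite <- Y2. apply RInt_abs_le; [lra|exact X1|exact Y1|].
    intros s Hs. eapply Rle_trans; [apply fst_le_Cmod|apply Bd, Hs]. }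
  assert (I2 : Rabs (RInt (fun s => snd (F s)) 0 1) <= c * M * RInt (radial_weight alpha g theta) 0 t).
  { rewrite <- Y2. apply RInt_abs_le; [lra|exact X2|exact Y1|].
    intros s Hs. eapply Rle_trans; [apply snd_le_Cmod|apply Bd, Hs]. }
  specialize (HK t theta Ht Hth).
  set (I := RInt (radial_weight alpha g theta) 0 t) in *.
  apply Rle_trans with (Rpower (1 - t ^ 2) beta * (2 * (c * M * I))).
  - apply Rmult_le_compat_l; [apply Rlt_le, Rpower_pos|].
    eapply Rle_trans; [apply Cmod_le_abs|]. cbn [fst snd].
    change (Rabs (RInt (fun s => fst (F s)) 0 1) + Rabs (RInt (fun s => snd (F s)) 0 1) <=
      2 * (c * M * I)). lra.
  - replace (Rpower (1 - t ^ 2) beta * (2 * (c * M * I))) with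
      (2 * c * M * (Rpower (1 - t ^ 2) beta * I)) by ring.
    replace (2 * c * K * M) with (2 * c * M * K) by ring.
    apply Rmult_le_compat_l; [|exact HK]. apply Rmult_le_pos; lra.
Qed.

(** * Concentrated rational kernels *)

(** This is [tanh (s / 2)], the radius at hyperbolic distance [s] from the origin. Its derivative
    [(1 - rad s ^ 2) / 2] is what turns the Bloch condition into a Lipschitz condition in [s]. *)
Definition rad (s : R) : R := (1 - exp (- s)) / (1 + exp (- s)).

Lemma rad_bounds (s : R) : 0 <= s -> 0 <= rad s < 1.
Proof.
  intros Hs. assert (E0 := exp_pos (- s)).
  assert (E1 : exp (- s) <= 1).
  { rewrite <- exp_0. destruct Hs as [Hs| <-]; [apply Rlt_le, exp_increasing; lra|].
    rewrite Ropp_0. lra. }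
  unfold rad. split.
  - apply Rmult_le_pos; [lra|]. apply Rlt_le, Rinv_0_lt_compat. lra.
  - apply Rmult_lt_reg_r with (1 + exp (- s)); [lra|].
    unfold Rdiv. rewrite Rmult_assoc, Rinv_l by lra. lra.
Qed.

Lemma rad_mono (s t : R) : s <= t -> rad s <= rad t.
Proof.
  intros H. assert (E0 := exp_pos (- s)). assert (E1 := exp_pos (- t)).
  assert (E2 : exp (- t) <= exp (- s)).
  { destruct H as [H| ->]; [apply Rlt_le, exp_increasing; lra|lra]. }
  unfold rad. apply Rmult_le_reg_r with ((1 + exp (- s)) * (1 + exp (- t))); [nra|].
  replace ((1 - exp (- s)) / (1 + exp (- s)) * ((1 + exp (- s)) * (1 + exp (- t))))
    with ((1 - exp (- s)) * (1 + exp (- t))) by (field; lra).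
  replace ((1 - exp (- t)) / (1 + exp (- t)) * ((1 + exp (- s)) * (1 + exp (- t))))
    with ((1 - exp (- t)) * (1 + exp (- s))) by (field; lra).
  nra.
Qed.

Lemma rad_pos (s : R) : 0 < s -> 0 < rad s.
Proof.
  intros Hs. assert (E0 := exp_pos (- s)).
  assert (E1 : exp (- s) < 1) by (rewrite <- exp_0; apply exp_increasing; lra).
  apply Rdiv_lt_0_compat; lra.
Qed.

Lemma rad_surj (r : R) : 0 <= r < 1 -> exists s, 0 <= s /\ rad s = r.
Proof.
  intros Hr. exists (- ln ((1 - r) / (1 + r))).
  assert (P : 0 < (1 - r) / (1 + r)) by (apply Rdiv_lt_0_compat; lra).
  split.
  - assert (ln ((1 - r) / (1 + r)) <= ln 1); [|rewrite ln_1 in *; lra].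
    apply ln_le; [exact P|]. apply Rmult_le_reg_r with (1 + r); [lra|].
    unfold Rdiv. rewrite Rmult_assoc, Rinv_l by lra. lra.
  - unfold rad. rewrite Ropp_involutive, exp_ln by exact P. field. lra.
Qed.

(* [rho_kernel s t] is [1 - d^2], [d] the pseudohyperbolic distance of [rad s] and [rad t]. *)
Definition rho_kernel (s t : R) : R := 4 * exp (t - s) / (1 + exp (t - s)) ^ 2.

Lemma rho_kernel_rad (s t : R) :
  (1 - rad s ^ 2) * (1 - rad t ^ 2) = rho_kernel s t * (1 - rad s * rad t) ^ 2.
Proof.
  unfold rad, rho_kernel.
  replace (exp (t - s)) with (exp (- s) / exp (- t)).
  2:{ unfold Rdiv. rewrite <- exp_Ropp, <- exp_plus. f_equal. ring. }
  assert (E0 := exp_pos (- s)). assert (E1 := exp_pos (- t)).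
  field. repeat split; nra.
Qed.

Lemma rho_kernel_pos (s t : R) : 0 < rho_kernel s t.
Proof.
  unfold rho_kernel. assert (E0 := exp_pos (t - s)).
  apply Rdiv_lt_0_compat; [lra|]. apply pow_lt. lra.
Qed.

(** The kernel is [1 / cosh^2] of half the difference, hence even. *)
Lemma rho_kernel_abs (s t : R) : rho_kernel s t = rho_kernel 0 (Rabs (t - s)).
Proof.
  unfold rho_kernel. rewrite Rminus_0_r. unfold Rabs. destruct (Rcase_abs (t - s)); [|reflexivity].
  rewrite exp_Ropp. assert (E0 := exp_pos (t - s)). field. split; nra.
Qed.

Lemma rho_kernel_decr (x y : R) : 0 <= x < y -> rho_kernel 0 y < rho_kernel 0 x.
Proof.
  intros H. unfold rho_kernel. rewrite !Rminus_0_r.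
  assert (E : exp x < exp y) by (apply exp_increasing; lra).
  assert (E0 : 1 <= exp x).
  { rewrite <- exp_0. destruct H as [[H| <-] _]; [apply Rlt_le, exp_increasing, H|lra]. }
  set (a := exp x) in *. set (b := exp y) in *.
  apply Rlt_0_minus.
  replace (4 * a / (1 + a) ^ 2 - 4 * b / (1 + b) ^ 2) with
    (4 * ((b - a) * (a * b - 1)) / ((1 + a) ^ 2 * (1 + b) ^ 2)) by (field; lra).
  apply Rdiv_lt_0_compat; [|apply Rmult_lt_0_compat; apply pow_lt; lra].
  apply Rmult_lt_0_compat; [lra|]. apply Rmult_lt_0_compat; nra.
Qed.

Lemma rho_kernel_decr_le (x y : R) : 0 <= x <= y -> rho_kernel 0 y <= rho_kernel 0 x.
Proof.
  intros [H1 [H2| ->]]; [apply Rlt_le, rho_kernel_decr; lra|lra].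
Qed.

Lemma rho_kernel_le_1 (s t : R) : rho_kernel s t <= 1.
Proof.
  unfold rho_kernel. assert (E0 := exp_pos (t - s)). set (a := exp (t - s)) in *.
  apply Rmult_le_reg_r with ((1 + a) ^ 2); [apply pow_lt; lra|].
  replace (4 * a / (1 + a) ^ 2 * (1 + a) ^ 2) with (4 * a) by (field; lra).
  generalize (pow2_ge_0 (1 - a)). nra.
Qed.

Lemma Rpower_exp (x a : R) : Rpower (exp x) a = exp (a * x).
Proof. unfold Rpower. rewrite ln_exp. reflexivity. Qed.

(* Up to a constant, [rho_kernel s (n delta) ^ gamma] is bounded by an increment
   of the logistic function, hence the sum telescopes. *)
Lemma rho_kernel_sum (gamma delta : R) : 0 < gamma -> 0 < delta ->
  exists W, 0 < W /\ forall s N,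
    sum_f_R0 (fun n => Rpower (rho_kernel s (INR (S n) * delta)) gamma) N <= W.
Proof.
  intros Hg Hd. set (lam := exp (gamma * delta)).
  assert (Hl : 1 < lam) by (rewrite <- exp_0; apply exp_increasing, Rmult_lt_0_compat; assumption).
  (* [Rpower 4 gamma] is the 4 in [rho_kernel]; [lam - 1] comes from the increment of the logistic
     function, [lam] from [1 + lam * y <= lam * (1 + y)], and the second 4 from using
     [1 + y <= 2 * Q] twice. *)
  set (c := Rpower 4 gamma * 4 * (lam / (lam - 1))).
  assert (H4 := Rpower_pos 4 gamma).
  assert (Hlam : 0 < lam / (lam - 1)) by (apply Rdiv_lt_0_compat; lra).
  assert (Hc : 0 < c) by (unfold c; apply Rmult_lt_0_compat; [lra|exact Hlam]).
  exists c. split; [exact Hc|]. intros s N.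
  set (phi := fun x => exp (gamma * (x - s)) / (1 + exp (gamma * (x - s)))).
  assert (Hphi : forall x, 0 < phi x < 1).
  { intros x. unfold phi. assert (E := exp_pos (gamma * (x - s))). set (y := exp (gamma * (x - s))) in *. split.
    - apply Rdiv_lt_0_compat; lra.
    - apply Rmult_lt_reg_r with (1 + y); [lra|]. unfold Rdiv.
      rewrite Rmult_assoc, Rinv_l by lra. lra. }
  assert (T : forall x, Rpower (rho_kernel s x) gamma <= c * (phi (x + delta) - phi x)).
  { intros x. unfold rho_kernel. set (Y := exp (x - s)). assert (HY : 0 < Y) by apply exp_pos.
    set (y := exp (gamma * (x - s))). assert (Hy : 0 < y) by apply exp_pos.
    assert (E1 : Rpower Y gamma = y) by apply Rpower_exp.
    set (Q := Rpower (1 + Y) gamma).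
    assert (Q1 : 1 <= Q).
    { rewrite <- (Rpower_1_base gamma). apply Rle_Rpower_l; lra. }
    assert (Q2 : y <= Q) by (rewrite <- E1; apply Rle_Rpower_l; lra).
    assert (E2 : Rpower (4 * Y / (1 + Y) ^ 2) gamma * (Q * Q) = Rpower 4 gamma * y).
    { unfold Q. rewrite <- E1, Rpower_mult_distr by lra. rewrite !Rpower_mult_distr; try nra.
      - f_equal. field. lra.
      - apply Rdiv_lt_0_compat; nra. }
    assert (E3 : phi (x + delta) - phi x = (lam - 1) * y / ((1 + lam * y) * (1 + y))).
    { unfold phi. replace (exp (gamma * (x + delta - s))) with (lam * y).
      - fold y. field. nra.
      - unfold lam, y. rewrite <- exp_plus. f_equal. ring. }
    rewrite E3.
    apply Rmult_le_reg_r with (Q * Q); [nra|]. rewrite E2. unfold c.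
    replace (Rpower 4 gamma * 4 * (lam / (lam - 1)) * ((lam - 1) * y / ((1 + lam * y) * (1 + y))) * (Q * Q))
      with (Rpower 4 gamma * y * (4 * lam * (Q * Q) / ((1 + lam * y) * (1 + y)))) by (field; nra).
    rewrite <- (Rmult_1_r (Rpower 4 gamma * y)) at 1.
    apply Rmult_le_compat_l; [nra|].
    apply Rmult_le_reg_r with ((1 + lam * y) * (1 + y)); [nra|].
    replace (4 * lam * (Q * Q) / ((1 + lam * y) * (1 + y)) * ((1 + lam * y) * (1 + y)))
      with (4 * lam * (Q * Q)) by (field; nra).
    rewrite Rmult_1_l.
    apply Rle_trans with (lam * ((1 + y) * (1 + y))).
    - rewrite <- Rmult_assoc. apply Rmult_le_compat_r; [lra|]. nra.
    - replace (4 * lam * (Q * Q)) with (lam * ((2 * Q) * (2 * Q))) by ring.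
      apply Rmult_le_compat_l; [lra|]. apply Rmult_le_compat; lra. }
  assert (Tel : sum_f_R0 (fun n => Rpower (rho_kernel s (INR (S n) * delta)) gamma) N <=
    c * (phi (INR (S (S N)) * delta) - phi (INR 1 * delta))).
  { induction N.
    - cbn [sum_f_R0]. eapply Rle_trans; [apply T|]. right. f_equal. f_equal. f_equal.
      rewrite (S_INR 1). ring.
    - cbn [sum_f_R0]. eapply Rle_trans; [apply Rplus_le_compat; [exact IHN|apply T]|].
      replace (INR (S (S N)) * delta + delta) with (INR (S (S (S N))) * delta)
        by (rewrite (S_INR (S (S N))); ring). right; ring. }
  eapply Rle_trans; [exact Tel|].
  rewrite <- (Rmult_1_r c) at 2. apply Rmult_le_compat_l; [lra|].
  generalize (Hphi (INR (S (S N)) * delta)) (Hphi (INR 1 * delta)). lra.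
Qed.

(** * Rational kernels and their primitives *)

Lemma cderiv_pow (f : C -> C) (z l : C) (n : nat) : is_cderiv_at f z l ->
  is_cderiv_at (fun w => f w ^ S n)%C z (RtoC (INR (S n)) * f z ^ n * l)%C.
Proof.
  intros H. induction n.
  - apply (cderiv_ext f); [intros w; ring|].
    replace (RtoC (INR 1) * f z ^ 0 * l)%C with l by (simpl; ring). exact H.
  - apply (cderiv_ext (fun w => f w * f w ^ S n)%C); [reflexivity|].
    replace (RtoC (INR (S (S n))) * f z ^ S n * l)%C with
      (l * f z ^ S n + f z * (RtoC (INR (S n)) * f z ^ n * l))%C.
    + apply cderiv_mult; [exact H|exact IHn].
    + rewrite (S_INR (S n)), RtoC_plus, Cpow_S. ring.
Qed.

(** In [1 - z = (1 - a z) - (1 - a) z] the last term is at most [1 - a <= 1 - a |z|]. Thus each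
    factor [1 - z] can be paid for by a factor [1 - a z], uniformly in [a]. *)
Lemma one_minus_az_bound (a : R) (z : C) : 0 < a < 1 -> Cmod z < 1 ->
  1 - a * Cmod z <= Cmod (1 - RtoC a * z) /\ Cmod (1 - z) <= 2 * Cmod (1 - RtoC a * z).
Proof.
  intros Ha Hz. assert (Hz0 := Cmod_ge_0 z).
  assert (H1 : 1 - a * Cmod z <= Cmod (1 - RtoC a * z)).
  { assert (T := Cmod_triangle (1 - RtoC a * z) (RtoC a * z)).
    replace (1 - RtoC a * z + RtoC a * z)%C with (RtoC 1) in T by ring.
    rewrite Cmod_1, Cmod_mult, Cmod_R, (Rabs_pos_eq a) in T by lra. lra. }
  split; [exact H1|].
  replace (1 - z)%C with ((1 - RtoC a * z) + RtoC (- (1 - a)) * z)%C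
    by (rewrite RtoC_opp, RtoC_minus; ring).
  eapply Rle_trans; [apply Cmod_triangle|].
  rewrite Cmod_mult, Cmod_R, Rabs_Ropp, Rabs_pos_eq by lra. nra.
Qed.

Lemma cderiv_geom (a : R) (z : C) : 0 < a < 1 -> Cmod z < 1 ->
  is_cderiv_at (fun w => / (1 - RtoC a * w))%C z
    (RtoC a * / (1 - RtoC a * z) * / (1 - RtoC a * z))%C.
Proof.
  intros Ha Hz.
  assert (Hne : (- RtoC a * z + 1)%C <> 0%C).
  { apply Cmod_gt_0. replace (- RtoC a * z + 1)%C with (1 - RtoC a * z)%C by ring.
    destruct (one_minus_az_bound a z Ha Hz) as [H _]. assert (Hz0 := Cmod_ge_0 z). nra. }
  apply (cderiv_ext (fun w => / (- RtoC a * w + 1))%C).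
  { intros w. f_equal. ring. }
  replace (RtoC a * / (1 - RtoC a * z) * / (1 - RtoC a * z))%C with
    (- (/ (- RtoC a * z + 1) * / (- RtoC a * z + 1)) * (- RtoC a))%C.
  - apply (cderiv_affine Cinv). apply cderiv_inv. exact Hne.
  - replace (1 - RtoC a * z)%C with (- RtoC a * z + 1)%C by ring. ring.
Qed.

Lemma cderiv_one_minus (z : C) : is_cderiv_at (fun w => 1 - w)%C z (- (1))%C.
Proof.
  apply (cderiv_ext (fun w => - (1) * w + 1)%C); [intros; ring|].
  assert (D : is_cderiv_at (fun w => - (1) * w + 1)%C z (0 * z + - (1) * 1 + 0)%C).
  { apply cderiv_plus; [|apply cderiv_const].
    apply (cderiv_mult (fun _ => - (1))%C); [apply cderiv_const|apply cderiv_id]. }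
  replace (0 * z + - (1) * 1 + 0)%C with (- (1))%C in D by ring. exact D.
Qed.

(** The pole [1 / a] lies outside the closed disk; the zero at 1 forces decay along the radius
    beyond [a]. *)
Definition rat_kernel (a : R) (j m : nat) (z : C) : C := ((1 - z) ^ j * (/ (1 - RtoC a * z)) ^ m)%C.

(* Integration by parts lowers [j] and [m] together, so no logarithm ever appears. *)
Lemma rat_kernel_primitive (a1 : R) (j k : nat) : 0 < a1 ->
  exists K, 0 <= K /\ forall a, a1 <= a < 1 -> exists P : C -> C, forall z : C, Cmod z < 1 ->
    is_cderiv_at P z (rat_kernel a j (k + j + 2) z) /\
    Cmod (P z) <= K * / Cmod (1 - RtoC a * z) ^ (k + 1).
Proof.
  intros Ha1. induction j as [|j [K [HK IH]]].
  - exists (/ a1). split; [apply Rlt_le, Rinv_0_lt_compat, Ha1|]. intros a Ha.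
    exists (fun z => RtoC (/ (a * INR (S k))) * (/ (1 - RtoC a * z)) ^ S k)%C. intros z Hz.
    assert (Hk : 1 <= INR (S k)) by (rewrite S_INR; generalize (pos_INR k); lra).
    assert (Hi : / (a * INR (S k)) <= / a1) by (apply Rinv_le_contravar; nra).
    assert (Hi0 : 0 < / (a * INR (S k))) by (apply Rinv_0_lt_compat; nra).
    assert (Hne : (1 - RtoC a * z)%C <> 0%C).
    { apply Cmod_gt_0. destruct (one_minus_az_bound a z ltac:(lra) Hz) as [H _].
      assert (Hz0 := Cmod_ge_0 z). nra. }
    split.
    + unfold rat_kernel.
      replace (k + 0 + 2)%nat with (S (S k)) by lia.
      replace ((1 - z) ^ 0 * (/ (1 - RtoC a * z)) ^ S (S k))%C with
        (0 * (/ (1 - RtoC a * z)) ^ S k + RtoC (/ (a * INR (S k))) *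
          (RtoC (INR (S k)) * (/ (1 - RtoC a * z)) ^ k *
            (RtoC a * / (1 - RtoC a * z) * / (1 - RtoC a * z))))%C.
      * apply (cderiv_mult (fun _ => RtoC (/ (a * INR (S k))))); [apply cderiv_const|].
        apply (cderiv_pow (fun w => / (1 - RtoC a * w))%C). apply cderiv_geom; [lra|exact Hz].
      * rewrite !Cpow_S. set (v := (/ (1 - RtoC a * z))%C).
        transitivity (RtoC (/ (a * INR (S k)) * INR (S k) * a) * (v * (v * v ^ k)))%C.
        -- rewrite !RtoC_mult. ring.
        -- replace (/ (a * INR (S k)) * INR (S k) * a) with 1 by (field; lra).
           change ((1 - z) ^ 0)%C with (RtoC 1). ring.
    + rewrite Cmod_mult, Cmod_R, Rabs_pos_eq by lra.
      rewrite Cmod_pow, Cmod_inv, pow_inv by exact Hne.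
      replace (S k) with (k + 1)%nat at 2 by lia.
      apply Rmult_le_compat_r; [|exact Hi].
      apply Rlt_le, Rinv_0_lt_compat, pow_lt, Cmod_gt_0, Hne.
  (* [2 ^ S j] bounds the boundary term, by [one_minus_az_bound]; [INR (S j) * K] bounds the
     primitive of the lower kernel with the factor it acquires. *)
  - exists (/ a1 * (2 ^ S j + INR (S j) * K)).
    assert (HSj : 0 <= INR (S j)) by apply pos_INR.
    assert (H2j : 0 < 2 ^ S j) by (apply pow_lt; lra).
    assert (Hia : 0 < / a1) by (apply Rinv_0_lt_compat, Ha1).
    split; [apply Rmult_le_pos; nra|]. intros a Ha.
    destruct (IH a Ha) as [P HP]. clear IH.
    set (m := (k + j + 2)%nat) in *.
    (* The derivative of [(1 - z)^(j + 1) / (1 - a z)^m] is [a * m] times the wanted kernel minus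
       [j + 1] times the kernel with primitive [P]; [b] normalizes the former. *)
    set (b := / (a * INR m)).
    exists (fun z => RtoC b * ((1 - z) ^ S j * (/ (1 - RtoC a * z)) ^ m + RtoC (INR (S j)) * P z))%C.
    intros z Hz. destruct (HP z Hz) as [HP1 HP2].
    assert (Hm : 1 <= INR m).
    { replace m with (S (k + j + 1)) by (unfold m; lia). rewrite S_INR.
      generalize (pos_INR (k + j + 1)); lra. }
    assert (Hb : b <= / a1) by (apply Rinv_le_contravar; nra).
    assert (Hb0 : 0 < b) by (apply Rinv_0_lt_compat; nra).
    destruct (one_minus_az_bound a z ltac:(lra) Hz) as [B1 B2].
    assert (Hz0 := Cmod_ge_0 z).
    assert (Hpos : 0 < Cmod (1 - RtoC a * z)) by nra.
    assert (Hne : (1 - RtoC a * z)%C <> 0%C) by (apply Cmod_gt_0, Hpos).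
    split.
    + assert (Em : exists m', m = S m') by (exists (k + j + 1)%nat; unfold m; lia).
      destruct Em as [m' Em].
      replace (k + S j + 2)%nat with (S m) by (unfold m; lia).
      assert (D : is_cderiv_at
        (fun z => RtoC b * ((1 - z) ^ S j * (/ (1 - RtoC a * z)) ^ m + RtoC (INR (S j)) * P z))%C z
        (0 * ((1 - z) ^ S j * (/ (1 - RtoC a * z)) ^ m + RtoC (INR (S j)) * P z) +
         RtoC b * ((RtoC (INR (S j)) * (1 - z) ^ j * - (1)) * (/ (1 - RtoC a * z)) ^ m +
           (1 - z) ^ S j * (RtoC (INR m) * (/ (1 - RtoC a * z)) ^ m' *
             (RtoC a * / (1 - RtoC a * z) * / (1 - RtoC a * z))) +
           (0 * P z + RtoC (INR (S j)) * rat_kernel a j m z)))%C).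
      { apply (cderiv_mult (fun _ => RtoC b)
          (fun z => (1 - z) ^ S j * (/ (1 - RtoC a * z)) ^ m + RtoC (INR (S j)) * P z)%C);
          [apply cderiv_const|].
        apply (cderiv_plus (fun z => (1 - z) ^ S j * (/ (1 - RtoC a * z)) ^ m)%C
          (fun z => RtoC (INR (S j)) * P z)%C).
        - apply (cderiv_mult (fun z => (1 - z) ^ S j)%C (fun z => (/ (1 - RtoC a * z)) ^ m)%C).
          + apply (cderiv_pow (fun w => 1 - w)%C). apply cderiv_one_minus.
          + rewrite Em. apply (cderiv_pow (fun w => / (1 - RtoC a * w))%C).
            apply cderiv_geom; [lra|exact Hz].
        - apply (cderiv_mult (fun _ => RtoC (INR (S j))) P); [apply cderiv_const|exact HP1]. }
      replace (rat_kernel a (S j) (S m) z) with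
        (0 * ((1 - z) ^ S j * (/ (1 - RtoC a * z)) ^ m + RtoC (INR (S j)) * P z) +
         RtoC b * ((RtoC (INR (S j)) * (1 - z) ^ j * - (1)) * (/ (1 - RtoC a * z)) ^ m +
           (1 - z) ^ S j * (RtoC (INR m) * (/ (1 - RtoC a * z)) ^ m' *
             (RtoC a * / (1 - RtoC a * z) * / (1 - RtoC a * z))) +
           (0 * P z + RtoC (INR (S j)) * rat_kernel a j m z)))%C; [exact D|].
      unfold rat_kernel. set (v := (/ (1 - RtoC a * z))%C).
      transitivity (RtoC (b * INR m * a) * ((1 - z) ^ S j * (v ^ S m')  * v))%C.
      * rewrite !RtoC_mult, !Cpow_S. ring.
      * replace (b * INR m * a) with 1 by (unfold b; field; lra).
        rewrite <- Em, !Cpow_S. ring.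
    + rewrite Cmod_mult, Cmod_R, Rabs_pos_eq by lra.
      set (d := Cmod (1 - RtoC a * z)) in *.
      set (V := / d ^ (k + 1)). assert (HV : 0 < V) by (apply Rinv_0_lt_compat, pow_lt, Hpos).
      replace (/ a1 * (2 ^ S j + INR (S j) * K) * V) with
        (/ a1 * ((2 ^ S j + INR (S j) * K) * V)) by ring.
      apply Rmult_le_compat; [lra|apply Cmod_ge_0|exact Hb|].
      eapply Rle_trans; [apply Cmod_triangle|].
      rewrite Rmult_plus_distr_r. apply Rplus_le_compat.
      * rewrite Cmod_mult, !Cmod_pow, Cmod_inv by exact Hne. fold d.
        replace m with (S j + (k + 1))%nat by (unfold m; lia).
        rewrite pow_add, !pow_inv. fold V.
        rewrite <- Rmult_assoc. apply Rmult_le_compat_r; [lra|].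
        apply Rmult_le_reg_r with (d ^ S j); [apply pow_lt, Hpos|].
        rewrite Rmult_assoc, Rinv_l, Rmult_1_r by (apply pow_nonzero; lra).
        rewrite <- Rpow_mult_distr. apply pow_incr. split; [apply Cmod_ge_0|exact B2].
      * rewrite Cmod_mult, Cmod_R, (Rabs_pos_eq (INR (S j))) by exact HSj.
        rewrite Rmult_assoc. apply Rmult_le_compat_l; [exact HSj|exact HP2].
Qed.

(** * Test functions *)

Fixpoint csum (F : nat -> C) (N : nat) : C :=
  match N with O => F O | S N => (csum F N + F (S N))%C end.

Lemma cderiv_csum (F F' : nat -> C -> C) (z : C) (N : nat) :
  (forall n, is_cderiv_at (F n) z (F' n z)) ->
  is_cderiv_at (fun w => csum (fun n => F n w) N) z (csum (fun n => F' n z) N).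
Proof.
  intros H. induction N; [apply H|]. simpl.
  apply (cderiv_plus (fun w => csum (fun n => F n w) N)); [exact IHN|apply H].
Qed.

Lemma Cmod_csum (F : nat -> C) (N : nat) :
  Cmod (csum F N) <= sum_f_R0 (fun n => Cmod (F n)) N.
Proof.
  induction N; simpl; [lra|]. eapply Rle_trans; [apply Cmod_triangle|]. lra.
Qed.

Lemma csum_mult_l (c : C) (F : nat -> C) (N : nat) :
  (c * csum F N)%C = csum (fun n => c * F n)%C N.
Proof. induction N; simpl; [reflexivity|]. rewrite <- IHN. ring. Qed.

Lemma fst_csum (F : nat -> C) (N : nat) : fst (csum F N) = sum_f_R0 (fun n => fst (F n)) N.
Proof. induction N; simpl; [reflexivity|]. rewrite IHN. reflexivity. Qed.

(** Used with [n0] the node nearest to a point and [y] the possible negative parts. Subtracting [y]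
    also at [n0] is harmless and avoids removing a term from the sum. *)
Lemma sum_ge_one_term (x y : nat -> R) (b : R) (n0 N : nat) : (n0 <= N)%nat ->
  (forall n, - y n <= x n) -> (forall n, 0 <= y n) -> b <= x n0 ->
  b - sum_f_R0 y N <= sum_f_R0 x N.
Proof.
  intros Hn Hx Hy Hb.
  assert (K : forall N, - sum_f_R0 y N <= sum_f_R0 x N).
  { induction N0; simpl; [apply Hx|]. generalize (Hx (S N0)). lra. }
  induction N.
  - replace n0 with O in Hb by lia. simpl. generalize (Hy O). lra.
  - simpl. destruct (Nat.eq_dec n0 (S N)) as [->|Hne].
    + generalize (K N) (Hy (S N)). lra.
    + generalize (IHN ltac:(lia)) (Hx (S N)). lra.
Qed.

Lemma Cmod_unit (x : R) : Cmod (cos x, sin x) = 1.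
Proof.
  assert (H := Cmod_polar 1 x). unfold polar in H. rewrite !Rmult_1_l, Rabs_R1 in H. exact H.
Qed.

Lemma cos_ge_half (x : R) : Rabs x <= 1 -> / 2 <= cos x.
Proof.
  intros Hx. destruct (pre_cos_bound x 0) as [H _].
  - apply Rabs_le_between in Hx. lra.
  - apply Rabs_le_between in Hx. lra.
  - unfold cos_approx, cos_term in H. simpl in H.
    apply Rabs_le_between in Hx. nra.
Qed.

Lemma kernel_weight_split (B X D p e : R) : 0 < B -> 0 < X -> 0 < D ->
  Rpower B p * Rpower X e / Rpower D (p + e) = Rpower (B / D) p * Rpower (X / D) e.
Proof.
  intros HB HX HD. unfold Rdiv at 1. rewrite <- Rpower_Ropp.
  replace (- (p + e)) with (- p + - e) by ring. rewrite Rpower_plus, !Rpower_Ropp.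
  unfold Rdiv. rewrite <- !Rpower_mult_distr by (try apply Rinv_0_lt_compat; assumption).
  assert (I : forall q, Rpower (/ D) q = / Rpower D q).
  { intros q. unfold Rpower. rewrite ln_Rinv by exact HD. rewrite <- exp_Ropp. f_equal. ring. }
  rewrite !I. ring.
Qed.

(** The nodes start at [delta] instead of 0 because the primitives of the kernels are bounded only
    for [a] away from 0; points of [[0, delta]] are still within [delta] of the first node. *)
Lemma near_node (delta S0 : R) : 0 < delta ->
  exists N, forall s, 0 <= s <= S0 -> exists n, (n <= N)%nat /\ Rabs (s - INR (S n) * delta) <= delta.
Proof.
  intros Hd. destruct (INR_unbounded (S0 / delta)) as [N HN]. exists N.
  assert (HN' : S0 < INR N * delta).
  { apply Rmult_gt_compat_r with (r := delta) in HN; [|exact Hd].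
    replace (S0 / delta * delta) with S0 in HN by (field; lra). lra. }
  clear HN. revert S0 HN'. induction N; intros S0 HN' s Hs.
  - simpl in HN'. lra.
  - destruct (Rle_or_lt s (INR N * delta)) as [H|H].
    + destruct (Rlt_or_le s (INR N * delta)) as [H1|H1].
      * destruct (IHN s H1 s) as [n [Hn1 Hn2]]; [lra|]. exists n. split; [lia|exact Hn2].
      * exists N. split; [lia|]. rewrite S_INR. apply Rabs_le_between.
        replace s with (INR N * delta) by lra. lra.
    + exists N. split; [lia|]. rewrite S_INR in *. apply Rabs_le_between. lra.
Qed.

(** [U] stands for the argument of [g] along a radius. [K] and [c0] are chosen before [U] and [S0],
    which makes the final bound uniform in the radius and in the end point [t]. *)
Lemma test_function (alpha L : R) : 0 < alpha -> 0 <= L ->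
  exists K c0, 0 < c0 /\ forall (U : R -> R) (S0 : R),
    (forall s t, 0 <= s -> 0 <= t -> Rabs (U s - U t) <= L * Rabs (s - t)) ->
    exists f f' : C -> C,
      (forall z, Cmod z < 1 -> is_cderiv_at f z (f' z)) /\
      (forall z, Cmod z < 1 -> ccont f' z) /\
      (forall z, Cmod z < 1 -> Rpower (1 - Cmod z ^ 2) alpha * Cmod (f z) <= K) /\
      (forall s, 0 <= s <= S0 ->
        c0 / Rpower (1 - rad s ^ 2) (alpha + 1) <= fst (f' (RtoC (rad s)) * (cos (U s), sin (U s)))%C).
Proof.
  intros Ha HL.
  (* Within distance [2 * delta] the phase [U] varies by at most 1, so the cosine of the difference
     is at least one half. *)
  set (delta := / (2 * (L + 1))).
  assert (Hdel : 0 < delta) by (apply Rinv_0_lt_compat; lra).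
  assert (HdL : L * (2 * delta) <= 1).
  { replace 1 with (2 * (L + 1) * delta) by (unfold delta; field; lra). nra. }
  (* [tau] absorbs the fractional part of [alpha]: the powers of [1 - a_n z] must be integers, while
     the real constants [B n] may carry a real exponent. *)
  destruct (INR_unbounded alpha) as [J HJ]. set (tau := INR J - alpha).
  assert (Htau : 0 < tau) by (unfold tau; lra).
  (* Some node lies within [delta], with kernel at least [near]; nodes within [2 * delta] contribute
     nonnegatively; all others have kernel at most [far]. The strict gap [far < near] is what large
     [j] exploits. *)
  set (near := rho_kernel 0 delta). set (far := rho_kernel 0 (2 * delta)).
  assert (Hnear : 0 < near) by apply rho_kernel_pos.
  assert (Hfar : 0 < far) by apply rho_kernel_pos.
  assert (Hnf : far < near) by (apply rho_kernel_decr; lra).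
  assert (Hnear1 : near <= 1) by apply rho_kernel_le_1.
  assert (Hfar1 : far <= 1) by apply rho_kernel_le_1.
  destruct (rho_kernel_sum 1 delta Rlt_0_1 Hdel) as [W1 [HW1 HW1']].
  destruct (rho_kernel_sum alpha delta Ha Hdel) as [Wa [HWa HWa']].
  set (A := Rpower 2 (2 * tau)). assert (HA : 0 < A) by apply Rpower_pos.
  set (eta := Rpower near (1 + alpha) * Rpower (near / 2) (2 * tau)).
  assert (Heta : 0 < eta) by (apply Rmult_lt_0_compat; apply Rpower_pos).
  (* The nearest node will contribute at least [eta / 2 * near ^ j], the cosine costing the factor
     2; the far nodes together are to cost at most half of that. *)
  assert (Hj : exists j, A * W1 * far ^ j <= eta / 4 * near ^ j).
  { assert (HAW : 0 < A * W1) by (apply Rmult_lt_0_compat; assumption).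
    destruct (pow_lt_1_zero (far / near)) with (y := eta / 4 / (A * W1)) as [j Hj].
    - rewrite Rabs_pos_eq.
      + apply Rmult_lt_reg_r with near; [exact Hnear|]. unfold Rdiv.
        rewrite Rmult_assoc, Rinv_l by lra. lra.
      + apply Rlt_le, Rdiv_lt_0_compat; assumption.
    - apply Rdiv_lt_0_compat; lra.
    - exists j. specialize (Hj j (Nat.le_refl _)).
      assert (Hq : 0 < far / near) by (apply Rdiv_lt_0_compat; assumption).
      rewrite Rabs_pos_eq in Hj by (apply pow_le; lra).
      replace far with (far / near * near) at 1 by (field; lra).
      rewrite Rpow_mult_distr, <- Rmult_assoc.
      apply Rmult_le_compat_r; [apply pow_le; lra|].
      apply Rmult_lt_compat_l with (r := A * W1) in Hj; [|exact HAW].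
      replace (A * W1 * (eta / 4 / (A * W1))) with (eta / 4) in Hj by (field; split; lra). lra. }
  destruct Hj as [j Hj].
  (* The exponents obey two balance conditions, [p + alpha = k + 1] for the primitive and
     [p + j + alpha + 1 = m] for the kernel, so that only the ratios [B / D] and [X / D] survive.
     Moreover [p = (j + 1 + alpha) + 2 * tau], which leaves a positive power of [B / D] beside the
     power of [rho_kernel]. *)
  set (p := INR (j + J + 1) + tau). set (k := (2 * J + j)%nat). set (m := (k + j + 2)%nat).
  set (a := fun n => rad (INR (S n) * delta)).
  assert (Hnode : forall n, 0 < INR (S n) * delta).
  { intros n. apply Rmult_lt_0_compat; [apply lt_0_INR; lia|exact Hdel]. }
  assert (Ha01 : forall n, 0 < a n < 1).
  { intros n. split; [apply rad_pos, Hnode|apply rad_bounds, Rlt_le, Hnode]. }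
  assert (Ha1 : forall n, a O <= a n < 1).
  { intros n. split; [|apply Ha01]. apply rad_mono. apply Rmult_le_compat_r; [lra|].
    apply le_INR. lia. }
  destruct (rat_kernel_primitive (a O) j k (proj1 (Ha01 O))) as [KP [HKP HP]].
  set (P := fun n => proj1_sig (constructive_indefinite_description _ (HP (a n) (Ha1 n)))).
  assert (HPn : forall n z, Cmod z < 1 -> is_cderiv_at (P n) z (rat_kernel (a n) j m z) /\
    Cmod (P n z) <= KP * / Cmod (1 - RtoC (a n) * z) ^ (k + 1)).
  { intros n. unfold P. apply proj2_sig. }
  clearbody P. clear HP.
  set (B := fun n => 1 - a n ^ 2).
  assert (HB : forall n, 0 < B n) by (intros n; unfold B; generalize (Ha01 n); nra).
  assert (Hpa : p + alpha = INR (k + 1)).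
  { unfold p, tau, k. rewrite !plus_INR, mult_INR. simpl. ring. }
  assert (Hpa0 : 0 <= p - alpha).
  { unfold p, tau. rewrite !plus_INR. simpl. generalize (pos_INR j). lra. }
  assert (Hpm : p + (INR j + (alpha + 1)) = INR m).
  { unfold p, tau, m, k. rewrite !plus_INR, mult_INR. simpl. ring. }
  (* Both bounds below rest on [B X / D^2 = rho_kernel] and [B / D <= 2]. *)
  assert (Hgeo : forall n s, 0 <= s -> let X := 1 - rad s ^ 2 in let D := 1 - a n * rad s in
    let c := rho_kernel s (INR (S n) * delta) in
    0 < X /\ 0 < D /\ B n / D <= 2 /\ X / D <= 2 /\ B n / D * (X / D) = c).
  { intros n s Hs X D c. destruct (rad_bounds s Hs) as [R0 R1]. generalize (Ha01 n). intros A01.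
    assert (HX : 0 < X) by (unfold X; nra). assert (HD : 0 < D) by (unfold D; nra).
    split; [exact HX|]. split; [exact HD|]. repeat split.
    - apply Rmult_le_reg_r with D; [exact HD|]. unfold Rdiv. rewrite Rmult_assoc, Rinv_l by lra.
      unfold B, D. nra.
    - apply Rmult_le_reg_r with D; [exact HD|]. unfold Rdiv. rewrite Rmult_assoc, Rinv_l by lra.
      unfold X, D. nra.
    - assert (E := rho_kernel_rad s (INR (S n) * delta)). fold (a n) in E.
      fold (B n) in E. fold X in E. fold c in E.
      apply Rmult_eq_reg_r with (D ^ 2); [|apply pow_nonzero; lra].
      replace (B n / D * (X / D) * D ^ 2) with (X * B n) by (field; lra).
      rewrite E. unfold D. ring. }
  exists (KP * Rpower 2 (p - alpha) * Wa), (/ 2 ^ j * (eta / 4 * near ^ j)).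
  split.
  { apply Rmult_lt_0_compat; [apply Rinv_0_lt_compat, pow_lt; lra|].
    apply Rmult_lt_0_compat; [lra|apply pow_lt, Hnear]. }
  intros U S0 HU. destruct (near_node delta S0 Hdel) as [N HN].
  set (u := fun n => U (INR (S n) * delta)).
  (* The phase at the node is removed here, so that multiplication by [exp (i U)] leaves the real
     part [cos (U s - u n)]. *)
  set (w := fun n => (RtoC (Rpower (B n) p) * (cos (- u n), sin (- u n)))%C : C).
  exists (fun z => csum (fun n => w n * P n z)%C N),
    (fun z => csum (fun n => w n * rat_kernel (a n) j m z)%C N).
  assert (Hw : forall n, Cmod (w n) = Rpower (B n) p).
  { intros n. unfold w. rewrite Cmod_mult, Cmod_unit, Cmod_R, Rmult_1_r.
    apply Rabs_pos_eq, Rlt_le, Rpower_pos. }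
  split; [|split; [|split]].
  - intros z Hz.
    apply (cderiv_csum (fun n z => w n * P n z)%C (fun n z => w n * rat_kernel (a n) j m z)%C).
    intros n. replace (w n * rat_kernel (a n) j m z)%C with
      (0 * P n z + w n * rat_kernel (a n) j m z)%C by ring.
    apply (cderiv_mult (fun _ => w n) (P n)); [apply cderiv_const|apply HPn, Hz].
  - intros z Hz.
    assert (Cn : forall n, ccont (fun z => w n * rat_kernel (a n) j m z)%C z).
    { intros n. apply ccont_mult.
      - exact (cderiv_ccont _ _ _ (cderiv_const _ _)).
      - unfold rat_kernel.
        assert (Cp : forall (f : C -> C) i, ccont f z -> ccont (fun z => f z ^ i)%C z).
        { intros f i Hf. induction i; [exact (cderiv_ccont _ _ _ (cderiv_const _ _))|].
          exact (ccont_mult f (fun z => f z ^ i)%C z Hf IHi). }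
        apply ccont_mult; apply Cp.
        + exact (cderiv_ccont _ _ _ (cderiv_one_minus z)).
        + exact (cderiv_ccont _ _ _ (cderiv_geom (a n) z (Ha01 n) Hz)). }
    clear - Cn. induction N; [apply Cn|]. simpl.
    intros e He. destruct (IHN (e / 2)) as [d1 [H1 F1]]; [lra|].
    destruct (Cn (S N) (e / 2)) as [d2 [H2 F2]]; [lra|].
    exists (Rmin d1 d2). split; [apply Rmin_pos; assumption|]. intros v Hv.
    specialize (F1 v (Rlt_le_trans _ _ _ Hv (Rmin_l _ _))).
    specialize (F2 v (Rlt_le_trans _ _ _ Hv (Rmin_r _ _))).
    match goal with |- Cmod (?x + ?y - (?x' + ?y'))%C < _ =>
      replace (x + y - (x' + y'))%C with ((x - x') + (y - y'))%C by ring end.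
    eapply Rle_lt_trans; [apply Cmod_triangle|]. lra.
  - intros z Hz. set (t := Cmod z) in *.
    destruct (rad_surj t) as [s [Hs Es]]; [split; [apply Cmod_ge_0|exact Hz]|].
    (* Since [|1 - a_n z| >= 1 - a_n |z|], the estimate at [z] reduces to the point [|z| = rad s] of
       the positive radius, and the sum over nodes is bounded by [Wa] whatever [N] is. *)
    assert (T : forall n, Rpower (1 - t ^ 2) alpha * Cmod (w n * P n z) <=
      KP * Rpower 2 (p - alpha) * Rpower (rho_kernel s (INR (S n) * delta)) alpha).
    { intros n. destruct (Hgeo n s Hs) as (HX & HD & HBD & HXD & Hc).
      rewrite Es in HX, HD, HBD, HXD, Hc.
      set (X := 1 - t ^ 2) in *. set (D := 1 - a n * t) in *.
      rewrite Cmod_mult, Hw.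
      destruct (HPn n z Hz) as [_ HPz].
      assert (HP' : Cmod (P n z) <= KP * / Rpower D (p + alpha)).
      { eapply Rle_trans; [exact HPz|]. apply Rmult_le_compat_l; [exact HKP|].
        rewrite Hpa, Rpower_pow by exact HD.
        apply Rinv_le_contravar; [apply pow_lt, HD|]. apply pow_incr. split; [lra|].
        exact (proj1 (one_minus_az_bound (a n) z (Ha01 n) Hz)). }
      apply Rle_trans with (KP * (Rpower (B n) p * Rpower X alpha / Rpower D (p + alpha))).
      - replace (KP * (Rpower (B n) p * Rpower X alpha / Rpower D (p + alpha))) with
          (Rpower X alpha * (Rpower (B n) p * (KP * / Rpower D (p + alpha)))) by (unfold Rdiv; ring).
        apply Rmult_le_compat_l; [apply Rlt_le, Rpower_pos|].
        apply Rmult_le_compat_l; [apply Rlt_le, Rpower_pos|exact HP'].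
      - rewrite kernel_weight_split by auto. rewrite Rmult_assoc.
        apply Rmult_le_compat_l; [exact HKP|].
        assert (Q1 : 0 < B n / D) by (apply Rdiv_lt_0_compat; auto).
        assert (Q2 : 0 < X / D) by (apply Rdiv_lt_0_compat; auto).
        replace p with ((p - alpha) + alpha) at 1 by ring.
        rewrite Rpower_plus, Rmult_assoc, Rpower_mult_distr, Hc by assumption.
        apply Rmult_le_compat_r; [apply Rlt_le, Rpower_pos|].
        apply Rle_Rpower_l; [exact Hpa0|lra]. }
    eapply Rle_trans; [apply Rmult_le_compat_l; [apply Rlt_le, Rpower_pos|apply Cmod_csum]|].
    apply Rle_trans with (KP * Rpower 2 (p - alpha) *
      sum_f_R0 (fun n => Rpower (rho_kernel s (INR (S n) * delta)) alpha) N).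
    + rewrite !scal_sum. apply sum_Rle. intros n _.
      rewrite Rmult_comm, (Rmult_comm (Rpower (rho_kernel _ _) _)). apply T.
    + apply Rmult_le_compat_l; [|apply HWa'].
      apply Rmult_le_pos; [exact HKP|apply Rlt_le, Rpower_pos].
  - intros s Hs. destruct (rad_bounds s (proj1 Hs)) as [R0 R1].
    set (r := rad s) in *. set (X := 1 - r ^ 2).
    assert (HX : 0 < X) by (unfold X; nra).
    (* The size of the [n]-th term on the radius, relative to [X^(- alpha - 1)]. The factor
       [(1 + r)^j] in [Ed] arises from [1 - r = X / (1 + r)]. *)
    set (d := fun n => Rpower (rho_kernel s (INR (S n) * delta)) (INR j + 1 + alpha) *
      Rpower (B n / (1 - a n * r)) (2 * tau)).
    assert (Ed : forall n, Rpower (B n) p * ((1 - r) ^ j / (1 - a n * r) ^ m) =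
      / (1 + r) ^ j * d n / Rpower X (alpha + 1)).
    { intros n. destruct (Hgeo n s (proj1 Hs)) as (_ & HD & HBD & HXD & Hc).
      fold r in HD, HBD, HXD, Hc. fold X in HXD, Hc. set (D := 1 - a n * r) in *.
      assert (Q1 : 0 < B n / D) by (apply Rdiv_lt_0_compat; auto).
      assert (Q2 : 0 < X / D) by (apply Rdiv_lt_0_compat; auto).
      assert (E : d n = Rpower (B n) p * Rpower X (INR j + (alpha + 1)) /
        Rpower D (p + (INR j + (alpha + 1)))).
      { rewrite kernel_weight_split by auto. unfold d. fold D. rewrite <- Hc.
        rewrite <- Rpower_mult_distr by assumption.
        replace p with ((INR j + 1 + alpha) + 2 * tau).
        - rewrite (Rpower_plus (INR j + 1 + alpha) (2 * tau)).
          replace (INR j + (alpha + 1)) with (INR j + 1 + alpha) by ring. ring.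
        - unfold p, tau. rewrite !plus_INR. simpl. ring. }
      rewrite E, Hpm, Rpower_plus, !Rpower_pow by assumption.
      replace X with ((1 - r) * (1 + r)) at 1 by (unfold X; ring).
      rewrite Rpow_mult_distr.
      assert (P1 : 0 < (1 + r) ^ j) by (apply pow_lt; lra).
      assert (P2 : 0 < D ^ m) by (apply pow_lt, HD).
      assert (P3 := Rpower_pos X (alpha + 1)).
      field. repeat split; lra. }
    assert (Ef : fst (csum (fun n => w n * rat_kernel (a n) j m (RtoC r))%C N *
        (cos (U s), sin (U s)))%C =
      / (1 + r) ^ j / Rpower X (alpha + 1) * sum_f_R0 (fun n => d n * cos (U s - u n)) N).
    { rewrite Cmult_comm, csum_mult_l, fst_csum, scal_sum. apply sum_eq. intros n _.
      destruct (Hgeo n s (proj1 Hs)) as (_ & HD & _). fold r in HD.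
      assert (Er : rat_kernel (a n) j m (RtoC r) = RtoC ((1 - r) ^ j / (1 - a n * r) ^ m)).
      { unfold rat_kernel. unfold Rdiv. rewrite RtoC_mult, RtoC_pow, <- pow_inv, RtoC_pow.
        rewrite RtoC_inv by lra. rewrite !RtoC_minus, RtoC_mult. reflexivity. }
      rewrite Er. unfold w.
      replace ((cos (U s), sin (U s)) *
        (RtoC (Rpower (B n) p) * (cos (- u n), sin (- u n)) * RtoC ((1 - r) ^ j / (1 - a n * r) ^ m)))%C
        with (RtoC (Rpower (B n) p * ((1 - r) ^ j / (1 - a n * r) ^ m)) *
          ((cos (U s), sin (U s)) * (cos (- u n), sin (- u n))))%C by (rewrite RtoC_mult; ring).
      rewrite Ed. unfold Cmult, RtoC; cbn [fst snd].
      rewrite cos_minus, cos_neg, sin_neg. unfold Rdiv. ring. }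
    rewrite Ef.
    assert (Hd0 : forall n, 0 < d n) by (intros n; apply Rmult_lt_0_compat; apply Rpower_pos).
    assert (Hsplit : forall c, 0 < c -> Rpower c (INR j + 1 + alpha) = c ^ j * Rpower c (1 + alpha)).
    { intros c Hc. rewrite Rplus_assoc, Rpower_plus, Rpower_pow by exact Hc. reflexivity. }
    assert (HUn : forall n, Rabs (s - INR (S n) * delta) <= 2 * delta -> / 2 <= cos (U s - u n)).
    { intros n Hn. apply cos_ge_half. eapply Rle_trans; [apply HU|].
      - apply Hs.
      - apply Rlt_le, Hnode.
      - apply Rle_trans with (L * (2 * delta)); [|exact HdL]. apply Rmult_le_compat_l; lra. }
    destruct (HN s Hs) as [n0 [Hn0 Hn0']].
    assert (Low : eta / 4 * near ^ j <= sum_f_R0 (fun n => d n * cos (U s - u n)) N).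
    { assert (Sm := sum_ge_one_term (fun n => d n * cos (U s - u n))
        (fun n => Rpower (rho_kernel s (INR (S n) * delta)) 1 * (A * far ^ j)) (eta / 2 * near ^ j) n0 N Hn0).
      eapply Rle_trans; [|apply Sm; clear Sm].
      - rewrite <- scal_sum.
        assert (Q := HW1' s N).
        assert (0 < A * far ^ j) by (apply Rmult_lt_0_compat; [exact HA|apply pow_lt, Hfar]).
        assert (A * far ^ j * sum_f_R0 (fun n => Rpower (rho_kernel s (INR (S n) * delta)) 1) N
          <= A * far ^ j * W1) by (apply Rmult_le_compat_l; lra). lra.
      - intros n. set (c := rho_kernel s (INR (S n) * delta)).
        assert (Hc : 0 < c) by apply rho_kernel_pos.
        assert (Hy : 0 < Rpower c 1 * (A * far ^ j)).
        { apply Rmult_lt_0_compat; [apply Rpower_pos|].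
          apply Rmult_lt_0_compat; [exact HA|apply pow_lt, Hfar]. }
        destruct (Rle_or_lt (Rabs (s - INR (S n) * delta)) (2 * delta)) as [Hn|Hn].
        + assert (H1 := HUn n Hn). assert (H2 := Hd0 n). nra.
        + assert (Hcf : c <= far).
          { unfold c. rewrite rho_kernel_abs. apply rho_kernel_decr_le.
            rewrite Rabs_minus_sym. lra. }
          (* Of the power [j + 1 + alpha] of [c], the [j]-th power gives smallness, one factor is
             kept to sum over the nodes, and the power [alpha] is bounded by 1. *)
          assert (Hdn : d n <= Rpower c 1 * (A * far ^ j)).
          { unfold d. fold c. rewrite Hsplit by exact Hc. rewrite Rpower_plus.
            destruct (Hgeo n s (proj1 Hs)) as (_ & HD & HBD & _). fold r in HD, HBD.
            assert (Q1 : 0 < B n / (1 - a n * r)) by (apply Rdiv_lt_0_compat; auto).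
            assert (Z1 : Rpower (B n / (1 - a n * r)) (2 * tau) <= A) by (apply Rle_Rpower_l; lra).
            assert (Z2 : c ^ j <= far ^ j) by (apply pow_incr; lra).
            assert (Z3 : Rpower c alpha <= 1).
            { apply Rpower_le_1; [split; [exact Hc|apply rho_kernel_le_1]|lra]. }
            assert (V1 := Rpower_pos c 1). assert (V2 := Rpower_pos c alpha).
            assert (V3 : 0 < c ^ j) by (apply pow_lt, Hc).
            assert (V4 := Rpower_pos (B n / (1 - a n * r)) (2 * tau)).
            replace (Rpower c 1 * (A * far ^ j)) with (far ^ j * (Rpower c 1 * 1) * A) by ring.
            apply Rmult_le_compat; [|lra| |exact Z1].
            - apply Rmult_le_pos; [lra|]. apply Rmult_le_pos; lra.
            - apply Rmult_le_compat; [lra| |exact Z2|].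
              + apply Rmult_le_pos; lra.
              + apply Rmult_le_compat_l; lra. }
          assert (H1 := COS_bound (U s - u n)). assert (H2 := Hd0 n). nra.
      - intros n. apply Rmult_le_pos; [apply Rlt_le, Rpower_pos|].
        apply Rmult_le_pos; [lra|apply pow_le; lra].
      - set (c := rho_kernel s (INR (S n0) * delta)).
        assert (Hc : near <= c).
        { unfold c. rewrite rho_kernel_abs. apply rho_kernel_decr_le.
          rewrite Rabs_minus_sym. split; [apply Rabs_pos|exact Hn0']. }
        assert (Hdn : eta * near ^ j <= d n0).
        { unfold d. fold c. rewrite Hsplit by lra. unfold eta.
          destruct (Hgeo n0 s (proj1 Hs)) as (_ & HD & HBD & HXD & Hcc).
          fold r in HD, HBD, HXD, Hcc. fold X in HXD, Hcc. fold c in Hcc.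
          set (q := B n0 / (1 - a n0 * r)) in *.
          assert (Q1 : 0 < q) by (apply Rdiv_lt_0_compat; auto).
          (* From [q * (X / D) = c >= near] and [X / D <= 2]. *)
          assert (Q2 : near / 2 <= q) by nra.
          assert (Z1 : Rpower (near / 2) (2 * tau) <= Rpower q (2 * tau)) by (apply Rle_Rpower_l; lra).
          assert (Z2 : near ^ j <= c ^ j) by (apply pow_incr; lra).
          assert (Z3 : Rpower near (1 + alpha) <= Rpower c (1 + alpha)) by (apply Rle_Rpower_l; lra).
          assert (V1 := Rpower_pos near (1 + alpha)). assert (V2 := Rpower_pos (near / 2) (2 * tau)).
          assert (V3 : 0 < near ^ j) by (apply pow_lt, Hnear).
          replace (Rpower near (1 + alpha) * Rpower (near / 2) (2 * tau) * near ^ j) with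
            (near ^ j * Rpower near (1 + alpha) * Rpower (near / 2) (2 * tau)) by ring.
          apply Rmult_le_compat; [|lra| |exact Z1].
          - apply Rmult_le_pos; lra.
          - apply Rmult_le_compat; lra. }
        assert (H1 := HUn n0 ltac:(lra)). assert (H2 := Hd0 n0).
        assert (0 < eta * near ^ j) by (apply Rmult_lt_0_compat; [exact Heta|apply pow_lt, Hnear]).
        apply Rle_trans with (eta * near ^ j * / 2); [lra|]. apply Rmult_le_compat; lra. }
    assert (Hr : / 2 ^ j <= / (1 + r) ^ j).
    { apply Rinv_le_contravar; [apply pow_lt; lra|]. apply pow_incr. lra. }
    assert (P3 := Rpower_pos X (alpha + 1)).
    assert (Hen : 0 < eta / 4 * near ^ j) by (apply Rmult_lt_0_compat; [lra|apply pow_lt, Hnear]).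
    assert (H2j : 0 < / 2 ^ j) by (apply Rinv_0_lt_compat, pow_lt; lra).
    replace (/ (1 + r) ^ j / Rpower X (alpha + 1) * sum_f_R0 (fun n => d n * cos (U s - u n)) N)
      with (/ (1 + r) ^ j * sum_f_R0 (fun n => d n * cos (U s - u n)) N / Rpower X (alpha + 1))
      by (unfold Rdiv; ring).
    apply Rmult_le_compat_r; [apply Rlt_le, Rinv_0_lt_compat, P3|].
    apply Rmult_le_compat; lra.
Qed.

(** * Necessity *)

(** By the chain rule the [s]-derivative is at most [(1 - r ^ 2) / 2 * |h'|] with [r = rad s], which
    the Bloch bound makes at most [M / 2]. *)
Lemma bloch_radial_lipschitz (h h' : C -> C) (M theta : R) : deriv_D h h' ->
  (forall z, in_D z -> (1 - Cnorm z ^ 2) * Cnorm (h' z) <= M) ->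
  forall s t, 0 <= s -> 0 <= t ->
    Rabs (snd (h (polar (rad s) theta)) - snd (h (polar (rad t) theta))) <= M / 2 * Rabs (s - t).
Proof.
  intros Hd HM s t Hs Ht.
  set (drad := fun x => (1 - rad x ^ 2) / 2).
  assert (Dr : forall x, is_derive rad x (drad x)).
  { intros x. unfold rad, drad, rad. assert (E := exp_pos (- x)).
    auto_derive; [lra|]. field. lra. }
  apply (mean_value_ineq (fun x => snd (h (polar (rad x) theta)))
    (fun x => drad x * snd (h' (polar (rad x) theta) * polar 1 theta)%C) t s).
  - intros x Hx.
    assert (Hx0 : 0 <= x) by (generalize (Rmin_glb t s 0); lra).
    assert (Hr := rad_bounds x Hx0).
    assert (D : is_derive (fun r => snd (h (polar r theta))) (rad x)
      (snd (h' (polar (rad x) theta) * polar 1 theta)%C)).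
    { apply (cderiv_path h (fun r => polar r theta) (polar 1 theta)).
      - intros r. apply polar_path.
      - apply Hd. change (Cmod (polar (rad x) theta) < 1). rewrite Cmod_polar, Rabs_pos_eq; lra. }
    exact (is_derive_comp _ rad x _ _ D (Dr x)).
  - intros x Hx.
    assert (Hx0 : 0 <= x) by (generalize (Rmin_glb t s 0); lra).
    assert (Hr := rad_bounds x Hx0).
    assert (Em : Cmod (polar (rad x) theta) = rad x) by (rewrite Cmod_polar, Rabs_pos_eq; lra).
    assert (B := HM (polar (rad x) theta)). unfold in_D in B.
    change (Cnorm (polar (rad x) theta)) with (Cmod (polar (rad x) theta)) in B. rewrite Em in B.
    specialize (B (proj2 Hr)).
    change (Cnorm (h' (polar (rad x) theta))) with (Cmod (h' (polar (rad x) theta))) in B.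
    assert (S1 : Rabs (snd (h' (polar (rad x) theta) * polar 1 theta)%C) <= Cmod (h' (polar (rad x) theta))).
    { eapply Rle_trans; [apply snd_le_Cmod|]. rewrite Cmod_mult, Cmod_polar, Rabs_R1. lra. }
    rewrite Rabs_mult. unfold drad. rewrite (Rabs_pos_eq ((1 - rad x ^ 2) / 2)) by nra.
    assert (0 <= 1 - rad x ^ 2) by nra.
    assert ((1 - rad x ^ 2) * Rabs (snd (h' (polar (rad x) theta) * polar 1 theta)%C) <=
      (1 - rad x ^ 2) * Cmod (h' (polar (rad x) theta))) by (apply Rmult_le_compat_l; assumption).
    lra.
Qed.

Lemma limsup_finite_of_Sg_bounded (alpha beta : R) (g : C -> C) : 0 < alpha -> holo_D g ->
  (exists h h' : C -> C, in_Bloch h h' /\ forall z, in_D z -> Cexp (h z) = g z) ->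
  Sg_bounded alpha beta g -> limsup_finite alpha beta g.
Proof.
  intros Ha Hg (h & h' & [Hh [M HM]] & Hexp) [K HK].
  assert (HM0 : 0 <= M).
  { assert (D0 : in_D (RtoC 0)) by (change (Cmod (RtoC 0) < 1); rewrite Cmod_0; lra).
    eapply Rle_trans; [|exact (HM (RtoC 0) D0)].
    change (Cnorm (RtoC 0)) with (Cmod (RtoC 0)). rewrite Cmod_0.
    apply Rmult_le_pos; [lra|apply Cmod_ge_0]. }
  destruct (test_function alpha (M / 2) Ha ltac:(lra)) as (C1 & c0 & Hc0 & HT).
  (* The bound holds for every [t] in [(0, 1)], so the threshold is 0. *)
  exists (K * C1 / c0), 0. split; [lra|]. intros t Ht theta _.
  rewrite (Phi_eq alpha g theta Hg beta t) by lra.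
  destruct (rad_surj t ltac:(lra)) as [S0 [HS0 ES0]].
  set (U := fun s => snd (h (polar (rad s) theta))).
  destruct (HT U S0 (bloch_radial_lipschitz h h' M theta Hh HM)) as (f & f' & Fd & Fc & Fb & Fr).
  (* The test function lives on the positive radius; composing it with the rotation by [- theta]
     carries it to the radius of angle [theta]. *)
  set (e := (polar 1 (- theta)) : C).
  assert (He : Cmod e = 1) by (unfold e; rewrite Cmod_polar; apply Rabs_R1).
  assert (Hep : forall r, (e * polar r theta)%C = RtoC r).
  { intros r. unfold e, polar, Cmult, RtoC; cbn [fst snd]. rewrite cos_neg, sin_neg.
    assert (Q := sin2_cos2 theta). unfold Rsqr in Q. f_equal; [|ring].
    transitivity (r * (sin theta * sin theta + cos theta * cos theta)); [ring|rewrite Q; ring]. }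
  assert (Hez : forall z, Cmod (e * z + 0)%C = Cmod z).
  { intros z. replace (e * z + 0)%C with (e * z)%C by ring. rewrite Cmod_mult, He. ring. }
  set (f1 := fun z => f (e * z + 0)%C). set (f1' := fun z => (f' (e * z + 0) * e)%C).
  assert (D1 : deriv_D f1 f1').
  { intros z Hz. apply cderiv_affine. apply Fd. rewrite Hez. exact Hz. }
  assert (B1 : forall z, in_D z -> Rpower (1 - Cnorm z ^ 2) alpha * Cnorm (f1 z) <= C1).
  { intros z Hz. change (Cnorm z) with (Cmod z). rewrite <- (Hez z). apply Fb.
    rewrite Hez. exact Hz. }
  assert (Hpt : forall s, 0 <= s <= 1 -> Cmod (polar (t * s) theta) = t * s /\ 0 <= t * s < 1).
  { intros s Hs. assert (0 <= t * s < 1) by nra. rewrite Cmod_polar, Rabs_pos_eq by lra. auto. }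
  destruct (Sg_radial g theta Hg f1' t ltac:(lra)) as (X1 & X2 & ES).
  { intros s Hs. destruct (Hpt s Hs) as [E1 E2]. unfold f1'. apply ccont_mult.
    - intros eps Heps. destruct (Fc (e * polar (t * s) theta + 0)%C) with (eps := eps)
        as [d [Hd Hw]]; [rewrite Hez, E1; lra|exact Heps|].
      exists d. split; [exact Hd|]. intros v Hv. apply Hw.
      replace (e * v + 0 - (e * polar (t * s) theta + 0))%C with (e * (v - polar (t * s) theta))%C by ring.
      rewrite Cmod_mult, He, Rmult_1_l. exact Hv.
    - exact (cderiv_ccont _ _ _ (cderiv_const e _)). }
  set (F := fun s => (f1' (polar (t * s) theta) * g (polar (t * s) theta) * polar t theta)%C) in *.
  destruct (radial_weight_rescale alpha g theta Hg t c0 ltac:(lra)) as [Y1 Y2].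
  assert (Low : forall s, 0 < s < 1 ->
    c0 * (t * radial_weight alpha g theta (t * s + 0)) <= fst (F s)).
  { intros s Hs. destruct (Hpt s ltac:(lra)) as [E1 E2]. rewrite Rplus_0_r.
    destruct (rad_surj (t * s) E2) as [sg [Hsg Esg]].
    assert (HsS : sg <= S0).
    { apply Rnot_lt_le. intros Hlt. assert (Hm := rad_mono S0 sg ltac:(lra)).
      rewrite ES0, Esg in Hm. nra. }
    specialize (Fr sg (conj Hsg HsS)). rewrite Esg in Fr.
    assert (Eg : g (polar (t * s) theta) =
      (RtoC (Cmod (g (polar (t * s) theta))) * (cos (U sg), sin (U sg)))%C).
    { assert (HD : in_D (polar (t * s) theta)) by (change (Cmod (polar (t * s) theta) < 1); lra).
      rewrite <- (Hexp _ HD). unfold U. rewrite Esg.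
      set (z := h (polar (t * s) theta)).
      replace (Cexp z) with (RtoC (exp (fst z)) * (cos (snd z), sin (snd z)))%C.
      - rewrite Cmod_mult, Cmod_unit, Cmod_R, Rmult_1_r, Rabs_pos_eq by (apply Rlt_le, exp_pos).
        reflexivity.
      - unfold Cexp, Cmult, RtoC; cbn [fst snd]. f_equal; ring. }
    (* The factor [e] from the chain rule turns [polar t theta] into [t], and the argument of [g] is
       exactly the phase against which [f'] was built; so the real part of [F s] is bounded below by
       the radial weight. *)
    assert (EF : F s = (RtoC (t * Cmod (g (polar (t * s) theta))) *
       (f' (RtoC (t * s)) * (cos (U sg), sin (U sg))))%C).
    { unfold F, f1'. rewrite Eg at 1.
      replace (e * polar (t * s) theta + 0)%C with (RtoC (t * s)) by (rewrite Hep; ring).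
      set (y := f' (RtoC (t * s))). rewrite RtoC_mult, <- (Hep t). ring. }
    rewrite EF. unfold radial_weight.
    set (N := Cmod (g (polar (t * s) theta))) in *. assert (HN : 0 <= N) by apply Cmod_ge_0.
    set (Z := (f' (RtoC (t * s)) * (cos (U sg), sin (U sg)))%C) in *.
    replace (fst (RtoC (t * N) * Z)%C) with (t * N * fst Z)
      by (unfold Cmult, RtoC; cbn [fst snd]; ring).
    replace (c0 * (t * (N / Rpower (1 - (t * s) ^ 2) (alpha + 1)))) with
      (t * N * (c0 / Rpower (1 - (t * s) ^ 2) (alpha + 1))) by (unfold Rdiv; ring).
    apply Rmult_le_compat_l; [nra|exact Fr]. }
  assert (I1 : c0 * RInt (radial_weight alpha g theta) 0 t <= Cmod (Sg g f1' (polar t theta))).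
  { rewrite <- Y2. rewrite ES. eapply Rle_trans; [|apply fst_le_Cmod].
    eapply Rle_trans; [|apply Rle_abs]. cbn [fst].
    apply RInt_le; [lra|exact Y1|exact X1|]. intros s Hs. apply Low. lra. }
  assert (HD : in_D (polar t theta)).
  { change (Cmod (polar t theta) < 1). rewrite Cmod_polar, Rabs_pos_eq; lra. }
  assert (Fin := HK f1 f1' D1 C1 B1 (polar t theta) HD).
  change (Cnorm (polar t theta)) with (Cmod (polar t theta)) in Fin.
  rewrite Cmod_polar, Rabs_pos_eq in Fin by lra.
  change (Cnorm (Sg g f1' (polar t theta))) with (Cmod (Sg g f1' (polar t theta))) in Fin.
  apply Rmult_le_reg_l with c0; [exact Hc0|].
  replace (c0 * (K * C1 / c0)) with (K * C1) by (field; lra).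
  eapply Rle_trans; [|exact Fin].
  rewrite <- Rmult_assoc, (Rmult_comm c0), Rmult_assoc.
  apply Rmult_le_compat_l; [apply Rlt_le, Rpower_pos|exact I1].
Qed.

Theorem theorem2 (alpha beta : R) (g : Cplx -> Cplx)
  (Halpha : 0 < alpha) (Hbeta : 0 <= beta)
  (Hg : holo_D g)
  (Hnz : forall z, in_D z -> g z <> C0)
  (Hlog : exists h h' : Cplx -> Cplx, in_Bloch h h' /\ forall z, in_D z -> Cexp (h z) = g z) :
  Sg_bounded alpha beta g <-> limsup_finite alpha beta g.
Proof.
  split.
  - exact (limsup_finite_of_Sg_bounded alpha beta g Halpha Hg Hlog).
  - exact (Sg_bounded_of_limsup_finite alpha beta g Halpha Hbeta Hg).
Qed.
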